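(* Let $M_n$ be a von Mangoldt plane with $G_n\ge0$, $\lim_{r\to\infty}n(r)=\infty$, and such that $n'(x)<\tfrac12$ for some $x>0$. Then for any $z>x$ there exists $y>z$ such that for every von Mangoldt plane $M_m$ with $m=n$ on $[0,y]$, the sets $r(\mathfrak C_m)$ and $[x,z]$ are disjoint.
   Context: For a smooth function $m\colon[0,\infty)\to[0,\infty)$ with $m(0)=0$, $m'(0)=1$, $m>0$ on $(0,\infty)$ and smooth odd extension, $M_m$ is $\mathbb R^2$ with metric $dr^2+m(r)^2d\theta^2$ (polar coordinates about origin $o$; $r$ is distance to $o$), curvature $G_m=-m''/m$; von Mangoldt means $G_m$ non-increasing in $r$. A ray is a unit speed geodesic on $[0,\infty)$ minimizing between any two of its points. $\mathfrak C_m$ is the set of points $q$ such that every unit tangent vector at $q$ makes angle $\le\pi/2$ with some ray from $q$. *)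

(* Defs.v *)
From Stdlib Require Import Reals.
From Coquelicot Require Import Coquelicot.
Open Scope R_scope.

(* Points of M_m are represented by Cartesian coordinates (x1,x2) in R^2,
   where polar coordinates (r,theta) about o = (0,0) are the usual ones. *)
Definition pt := (R * R)%type.

Definition eucl_dot (u v : pt) : R := fst u * fst v + snd u * snd v.
Definition eucl_norm (p : pt) : R := sqrt (eucl_dot p p).

Definition rad (p : pt) : R := eucl_norm p.

(* von Mangoldt plane profile: m : R -> R is the smooth odd extension *)
Definition profile (m : R -> R) : Prop :=
  (forall (k : nat) (t : R), ex_derive_n m k t) /\
  (forall t, m (- t) = - m t) /\
  m 0 = 0 /\
  is_derive m 0 1 /\
  (forall t, 0 < t -> 0 < m t).

Definition curv (m : R -> R) (r : R) : R := - Derive_n m 2 r / m r.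

Definition von_Mangoldt (m : R -> R) : Prop :=
  profile m /\
  (forall r1 r2, 0 < r1 -> r1 <= r2 -> curv m r2 <= curv m r1).

(* The Riemannian metric dr^2 + m(r)^2 dtheta^2 at p, written in Cartesian
   coordinates: with e = p/|p| (radial) and f = e rotated by pi/2,
   dr(u) = <u,e>, dtheta(u) = <u,f>/|p|.  At the origin the metric is
   Euclidean (m'(0)=1). *)
Definition gdot (m : R -> R) (p u v : pt) : R :=
  let r := rad p in
  match Req_EM_T r 0 with
  | left _ => eucl_dot u v
  | right _ =>
      let e := (fst p / r, snd p / r) in
      let f := (- snd p / r, fst p / r) in
      eucl_dot u e * eucl_dot v e
      + (m r) ^ 2 * (eucl_dot u f / r) * (eucl_dot v f / r)
  end.

Definition gnorm (m : R -> R) (p u : pt) : R := sqrt (gdot m p u u).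

Definition curve_vel (c : R -> pt) (t : R) : pt :=
  (Derive (fun s => fst (c s)) t, Derive (fun s => snd (c s)) t).

Definition C1_curve (c : R -> pt) : Prop :=
  (forall t, ex_derive (fun s => fst (c s)) t /\ ex_derive (fun s => snd (c s)) t) /\
  (forall t, continuous (fun s => fst (curve_vel c s)) t /\
             continuous (fun s => snd (curve_vel c s)) t).

Definition curve_length (m : R -> R) (c : R -> pt) : R :=
  RInt (fun t => gnorm m (c t) (curve_vel c t)) 0 1.

Definition gdist (m : R -> R) (p q : pt) : Rbar :=
  Glb_Rbar (fun L => exists c, C1_curve c /\ c 0 = p /\ c 1 = q /\
                               L = curve_length m c).

(* A ray: unit-speed geodesic on [0,oo) minimizing between any two of its
   points, i.e. a distance-preserving map [0,oo) -> M_m. *)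
Definition is_ray (m : R -> R) (g : R -> pt) : Prop :=
  forall s t, 0 <= s -> 0 <= t -> gdist m (g s) (g t) = Finite (Rabs (s - t)).

Definition init_vel (g : R -> pt) (w : pt) : Prop :=
  filterlim (fun h => (fst (g h) - fst (g 0)) / h) (at_right 0) (locally (fst w)) /\
  filterlim (fun h => (snd (g h) - snd (g 0)) / h) (at_right 0) (locally (snd w)).

(* C_m: points q such that every unit tangent vector at q makes angle
   <= pi/2 with (the initial velocity of) some ray from q.  For unit
   vectors v, w, angle(v,w) <= pi/2  <->  g_q(v,w) >= 0. *)
Definition in_Cm (m : R -> R) (q : pt) : Prop :=
  forall v : pt, gdot m q v v = 1 ->
    exists g w, is_ray m g /\ g 0 = q /\ init_vel g w /\ 0 <= gdot m q v w.

(* Main.v *)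
(* Let q have distance rho in [x, z] from o, and let a = n rho. Substituting s = m(r), a geodesic leaving q outward with
   Clairaut constant e turns by the integral of e / (s sqrt (s^2 - e^2)) ds / m'. Since m' < 1/2 beyond x, this is more than
   2 asin (e / a) as soon as the geodesic has reached a suitable radius Y; here y = Y + 1. So for every angle psi <= pi some
   geodesic with Clairaut constant c < a runs outward from q to the point P of radius Y at angle psi, of length
   c psi + (integral of sqrt (1 - c^2 / m^2)). If a ray from q passes through P and meets the circle r = rho again at angle u
   from q, then up to that moment it lasts at least the chord 2 a sin (u / 2) of the flat disc of radius a (as m' <= 1), and
   afterwards at least what the Clairaut functions e theta + (integral of sqrt (1 - e^2 / m^2)), which have gradient of norm
   one, give; choosing e well, the sum exceeds the length of the outward geodesic unless u = 0. Hence a ray never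
   comes back to r <= rho, and comparing with the Clairaut function of constant c < a shows that its initial velocity has
   positive radial part: no ray from q makes angle <= pi/2 with the inward direction. *)
Require Import Defs.
From Stdlib Require Import Reals Lra Psatz.
From Coquelicot Require Import Coquelicot.
Open Scope R_scope.

(** * Calculus *)

(** [is_ray] is purely metric: it preserves an infimum of lengths and carries neither a geodesic
    equation nor a Clairaut relation. So rays are never treated as solutions of an equation. Lower
    bounds on elapsed time come from functions whose increment along a curve is at most its length
    ([flat], [clairaut]), upper bounds from the length of explicit curves. The other obstacle is
    that [m] is prescribed on a bounded interval only. A ray is followed just until it first reaches
    radius [Y], and a nearly minimizing curve between two of its points may overshoot [Y]. The
    margin [y - Y] absorbs this: increments are estimated between points of the ray that are closer
    than the margin, and then chained. Quantitatively, the substitution s = m(r) gains a factor 1 /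
    m' of at least [1 / lam], while stopping at [Y] costs the fraction [eta]; [2 * lam + eta < 1] is
    what leaves more than 2 asin (e / a). *)

Lemma is_derive_continuous (f : R -> R) (x l : R) : is_derive f x l -> continuous f x.
Proof. intros H; apply (ex_derive_continuous (V := R_NormedModule)); now exists l. Qed.

Lemma derive_le_increment (f df : R -> R) (a b M : R) :
  a <= b ->
  (forall t, a < t < b -> is_derive f t (df t)) ->
  (forall t, a <= t <= b -> continuous f t) ->
  (forall t, a < t < b -> df t <= M) ->
  f b - f a <= M * (b - a).
Proof.
intros Hab Hd Hc Hle.
destruct (Rle_lt_or_eq_dec _ _ Hab) as [Hlt | ->]; [| lra].
assert (pr : forall c, a < c < b -> derivable_pt f c).
{ intros c H; exists (df c); apply is_derive_Reals; auto. }
destruct (MVT f id a b pr (fun c _ => derivable_pt_id c) Hlt) as [c [Hc' E]].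
- intros t Ht. apply continuity_pt_filterlim, Hc, Ht.
- intros t _. apply derivable_continuous_pt, derivable_pt_id.
- rewrite derive_pt_id in E. unfold id in E.
  assert (E2 : derive_pt f c (pr c Hc') = df c).
  { apply derive_pt_eq_0, is_derive_Reals; auto. }
  rewrite E2 in E. specialize (Hle c Hc'). nra.
Qed.

Lemma is_derive_RInt_continuous (g : R -> R) (a b c t : R) :
  a < c < b -> a < t < b -> (forall s, a < s < b -> continuous g s) ->
  is_derive (fun s => RInt g c s) t (g t).
Proof.
intros Hc Ht Hg.
apply is_derive_RInt with c; [| now apply Hg].
apply (locally_interval _ t a b); [apply Ht | apply Ht |].
intros s Hs1 Hs2. apply (RInt_correct (V := R_CompleteNormedModule)).
apply (ex_RInt_continuous (V := R_CompleteNormedModule)).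
intros u Hu. apply Hg. simpl in *.
revert Hu; unfold Rmin, Rmax; destruct Rle_dec; lra.
Qed.

(** Composition with it turns a function continuous on [[a, b]] into one continuous on the whole
    line, so that primitives are differentiable at the endpoints too. *)
Definition clamp (a b t : R) : R := Rmax a (Rmin b t).

Lemma clamp_bound (a b t : R) : a <= b -> a <= clamp a b t <= b.
Proof.
intros Hab; unfold clamp; split; [apply Rmax_l |].
apply Rmax_lub; [exact Hab | apply Rmin_l].
Qed.

Lemma clamp_id (a b t : R) : a <= t <= b -> clamp a b t = t.
Proof. intros Ht; unfold clamp; rewrite Rmin_right by lra; apply Rmax_right; lra. Qed.

Lemma continuous_clamp (a b t : R) : a <= b -> continuous (clamp a b) t.
Proof.
intros Hab. apply filterlim_locally. intros eps. exists eps. intros s Hs.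
change (Rabs (s - t) < eps) in Hs. change (Rabs (clamp a b s - clamp a b t) < eps).
eapply Rle_lt_trans; [| exact Hs].
unfold clamp, Rmax, Rmin, Rabs; repeat destruct Rle_dec; repeat destruct Rcase_abs; lra.
Qed.

Lemma continuous_comp_clamp (g : R -> R) (a b t : R) :
  a <= b -> (forall s, a <= s <= b -> continuous g s) ->
  continuous (fun s => g (clamp a b s)) t.
Proof.
intros Hab Hg. apply (continuous_comp (clamp a b) g).
- now apply continuous_clamp.
- now apply Hg, clamp_bound.
Qed.

(** For [s = 1] and [s = -1] the function [s * f - RInt h a] has derivative at most 0 on the
    interval; the two signs together bound the absolute value. *)
Lemma increment_le_RInt (f g : R -> R) (a b : R) :
  a <= b ->
  (forall t, a <= t <= b -> continuous g t) ->
  (forall t, a <= t <= b -> exists l, is_derive f t l /\ Rabs l <= g t) ->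
  Rabs (f b - f a) <= RInt g a b.
Proof.
intros Hab Hg Hf.
set (h := fun t => g (clamp a b t)).
assert (Hh : forall t, continuous h t) by (intros; now apply continuous_comp_clamp).
assert (HE : RInt g a b = RInt h a b).
{ apply (RInt_ext (V := R_CompleteNormedModule)). intros t Ht. unfold h. rewrite clamp_id; auto.
  rewrite Rmin_left, Rmax_right in Ht by lra. lra. }
rewrite HE.
assert (HL : forall t, is_derive (fun s => RInt h a s) t (h t)).
{ intros t. apply (is_derive_RInt_continuous h (Rmin a t - 1) (Rmax a t + 1)); auto;
  unfold Rmin, Rmax; destruct Rle_dec; lra. }
assert (Hf' : forall t, a <= t <= b -> is_derive f t (Derive f t) /\ Rabs (Derive f t) <= h t).
{ intros t Ht; destruct (Hf t Ht) as [l [H1 H2]]. unfold h. rewrite (clamp_id a b t Ht).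
  rewrite (is_derive_unique _ _ _ H1); auto. }
assert (key : forall s, s = 1 \/ s = -1 -> s * (f b - f a) <= RInt h a b).
{ intros s Hs.
  assert (HD : forall t, a <= t <= b ->
    is_derive (fun t => s * f t - RInt h a t) t (s * Derive f t - h t)).
  { intros t Ht.
    apply (is_derive_minus (V := R_NormedModule) (fun t => s * f t) (fun t => RInt h a t)); [| apply HL].
    apply (is_derive_scal f t s), Hf', Ht. }
  pose proof (derive_le_increment (fun t => s * f t - RInt h a t)
    (fun t => s * Derive f t - h t) a b 0 Hab) as H.
  assert (E : RInt h a a = 0) by apply (RInt_point (V := R_CompleteNormedModule) a h).
  cbv beta in H. rewrite E in H.
  assert (s * f b - RInt h a b - (s * f a - 0) <= 0 * (b - a)); [| lra].
  apply H.
  - intros t Ht; apply HD; lra.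
  - intros t Ht; apply is_derive_continuous with (1 := HD t Ht).
  - intros t Ht. destruct (Hf' t ltac:(lra)) as [_ Hb].
    apply Rabs_le_between in Hb. destruct Hs; subst s; lra. }
apply Rabs_le_between; split; [generalize (key (-1) ltac:(auto)) | generalize (key 1 ltac:(auto))]; lra.
Qed.

(** Chains steps of length [d / 2]. It serves where the bound is available only between points so
    close that nearly minimizing curves stay where the profile is controlled. *)
Lemma locally_short_is_short (f : R -> R) (a b d : R) :
  0 < d -> a <= b ->
  (forall s t, a <= s -> s <= t -> t <= b -> t - s < d -> Rabs (f t - f s) <= t - s) ->
  Rabs (f b - f a) <= b - a.
Proof.
intros Hd Hab H.
assert (Hn : forall n t, a <= t <= b -> t - a < INR n * (d / 2) -> Rabs (f t - f a) <= t - a).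
{ induction n as [| n IH]; intros t Ht Hlt.
  - simpl in Hlt; lra.
  - rewrite S_INR in Hlt.
    destruct (Rle_lt_dec (t - a) (d / 2)) as [Hs | Hs].
    + apply H; lra.
    + assert (H1 := IH (t - d / 2) ltac:(lra) ltac:(lra)).
      assert (H2 := H (t - d / 2) t ltac:(lra) ltac:(lra) ltac:(lra) ltac:(lra)).
      replace (f t - f a) with ((f t - f (t - d / 2)) + (f (t - d / 2) - f a)) by ring.
      eapply Rle_trans; [apply Rabs_triang |]; lra. }
destruct (INR_unbounded ((b - a) / (d / 2))) as [n Hn'].
apply (Hn n b); [lra |].
apply Rmult_lt_reg_r with (/ (d / 2)); [apply Rinv_0_lt_compat; lra |].
rewrite Rmult_assoc, Rinv_r by lra. unfold Rdiv in Hn' at 1. lra.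
Qed.

(** [t] is the supremum of the times with [f <= v]. Besides locating passages through a circle, this
    acts as an intermediate value theorem in [turn_onto]. *)
Lemma last_visit (f : R -> R) (T v : R) :
  0 <= T -> f 0 <= v -> v <= f T ->
  (forall s t, 0 <= s <= T -> 0 <= t <= T -> Rabs (f s - f t) <= Rabs (s - t)) ->
  exists t, 0 <= t <= T /\ f t = v /\ forall s, t <= s <= T -> v <= f s.
Proof.
intros HT H0 H1 Hlip.
destruct (completeness (fun t => 0 <= t <= T /\ f t <= v)) as [t [Hub Hlub]].
- exists T; intros t Ht; apply Ht.
- exists 0; lra.
- assert (Ht : 0 <= t <= T).
  { split; [apply Hub; lra | apply Hlub; intros s Hs; apply Hs]. }
  assert (Hgt : forall s, t < s <= T -> v < f s).
  { intros s Hs. apply Rnot_le_lt; intros Hle.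
    assert (s <= t); [apply Hub | lra]. lra. }
  assert (Hle : f t <= v).
  { apply Rnot_lt_le; intros Hlt.
    assert (t <= t - (f t - v) / 2); [| lra].
    apply Hlub. intros s [Hs1 Hs2].
    apply Rnot_lt_le; intros Hs3.
    assert (s <= t) by (apply Hub; auto).
    specialize (Hlip t s Ht Hs1).
    rewrite (Rabs_pos_eq (t - s)) in Hlip by lra.
    apply Rabs_le_between in Hlip. lra. }
  assert (Hge : v <= f t).
  { apply Rnot_lt_le; intros Hlt.
    destruct (Rle_lt_or_eq_dec t T ltac:(lra)) as [H | ->]; [| lra].
    set (s := t + Rmin (T - t) ((v - f t) / 2)).
    assert (t < s <= T /\ s - t <= (v - f t) / 2) as [Hs1 Hs2].
    { unfold s, Rmin; destruct Rle_dec; lra. }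
    specialize (Hgt s Hs1). specialize (Hlip s t ltac:(lra) Ht).
    rewrite (Rabs_pos_eq (s - t)) in Hlip by lra.
    apply Rabs_le_between in Hlip. lra. }
  exists t; repeat split; try lra.
  intros s Hs. destruct (Rle_lt_or_eq_dec t s ltac:(lra)) as [H | <-]; [left; apply Hgt |]; lra.
Qed.

Lemma first_visit (f : R -> R) (T v : R) :
  0 <= T -> f 0 <= v -> v <= f T ->
  (forall s t, 0 <= s <= T -> 0 <= t <= T -> Rabs (f s - f t) <= Rabs (s - t)) ->
  exists t, 0 <= t <= T /\ f t = v /\ forall s, 0 <= s <= t -> f s <= v.
Proof.
intros HT H0 H1 Hlip.
destruct (last_visit (fun t => - f (T - t)) T (- v)) as [t [Ht [Et Hs]]]; auto.
- rewrite Rminus_0_r; lra.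
- rewrite Rminus_diag; lra.
- intros s t Hs Ht.
  replace (- f (T - s) - - f (T - t)) with (f (T - t) - f (T - s)) by ring.
  replace (s - t) with ((T - t) - (T - s)) by ring. apply Hlip; lra.
- exists (T - t); repeat split; try lra.
  intros s Hs'. specialize (Hs (T - s) ltac:(lra)). cbv beta in Hs.
  replace (T - (T - s)) with s in Hs by ring. lra.
Qed.

(** * The metric *)

(** Off the origin, the differentials dr and dtheta evaluated at the vector [u] based at [p]. *)
Definition radial (p u : pt) : R := eucl_dot p u / rad p.
Definition angular (p u : pt) : R := (fst p * snd u - snd p * fst u) / (rad p) ^ 2.

Lemma rad_ge_0 (p : pt) : 0 <= rad p.
Proof. apply sqrt_pos. Qed.

Lemma rad_sqr (p : pt) : rad p * rad p = fst p * fst p + snd p * snd p.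
Proof. apply sqrt_sqrt. nra. Qed.

Lemma gdot_polar (m : R -> R) (p u : pt) :
  rad p <> 0 -> gdot m p u u = (radial p u) ^ 2 + (m (rad p) * angular p u) ^ 2.
Proof.
intros Hp. unfold gdot. destruct Req_EM_T as [E | _]; [easy |].
unfold radial, angular, eucl_dot; simpl. field. exact Hp.
Qed.

Lemma gnorm_polar (m : R -> R) (p u : pt) :
  rad p <> 0 -> gnorm m p u = sqrt ((radial p u) ^ 2 + (m (rad p) * angular p u) ^ 2).
Proof. intros Hp; unfold gnorm; now rewrite gdot_polar. Qed.

Lemma radial_angular_sqr (p u : pt) :
  rad p <> 0 -> (radial p u) ^ 2 + (rad p * angular p u) ^ 2 = eucl_dot u u.
Proof.
intros Hp. pose proof (rad_sqr p) as H. unfold radial, angular, eucl_dot in *.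
apply Rmult_eq_reg_r with (rad p * rad p); [| now apply Rmult_integral_contrapositive_currified].
transitivity ((fst p * fst u + snd p * snd u) ^ 2 + (fst p * snd u - snd p * fst u) ^ 2).
- field; auto.
- rewrite H; ring.
Qed.

Lemma gnorm_origin (m : R -> R) (p u : pt) : rad p = 0 -> gnorm m p u = eucl_norm u.
Proof. intros Hp. unfold gnorm, gdot. now destruct Req_EM_T. Qed.

Lemma Rabs_dot_le (a b x y : R) : Rabs (a * x + b * y) <= sqrt (a ^ 2 + b ^ 2) * sqrt (x ^ 2 + y ^ 2).
Proof.
rewrite <- sqrt_mult by nra. rewrite <- sqrt_Rsqr_abs.
apply sqrt_le_1_alt. unfold Rsqr. pose proof (pow2_ge_0 (a * y - b * x)). nra.
Qed.

Lemma curve_vel_is_derive (c : R -> pt) (t : R) :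
  C1_curve c ->
  is_derive (fun s => fst (c s)) t (fst (curve_vel c t)) /\
  is_derive (fun s => snd (c s)) t (snd (curve_vel c t)).
Proof. intros [H _]; split; apply Derive_correct, H. Qed.

Lemma is_derive_pythag (X Y : R -> R) (t x y : R) :
  is_derive X t x -> is_derive Y t y -> X t * X t + Y t * Y t <> 0 ->
  is_derive (fun s => sqrt (X s * X s + Y s * Y s)) t
    ((X t * x + Y t * y) / sqrt (X t * X t + Y t * Y t)).
Proof.
intros HX HY H0.
assert (Hpos : 0 < X t * X t + Y t * Y t) by nra.
assert (Hs : 0 < sqrt (X t * X t + Y t * Y t)) by now apply sqrt_lt_R0.
evar_last.
- apply (is_derive_sqrt (fun s => X s * X s + Y s * Y s)); [| exact Hpos].
  apply (is_derive_plus (V := R_NormedModule) (fun s => X s * X s) (fun s => Y s * Y s)).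
  + apply (is_derive_mult (K := R_AbsRing) X X); eauto. intros; apply Rmult_comm.
  + apply (is_derive_mult (K := R_AbsRing) Y Y); eauto. intros; apply Rmult_comm.
- unfold plus, mult; simpl. field. lra.
Qed.

Lemma rad_is_derive (c : R -> pt) (t : R) :
  C1_curve c -> rad (c t) <> 0 ->
  is_derive (fun s => rad (c s)) t (radial (c t) (curve_vel c t)).
Proof.
intros Hc H0. destruct (curve_vel_is_derive c t Hc) as [HX HY].
apply (is_derive_pythag _ _ _ _ _ HX HY).
rewrite <- rad_sqr; now apply Rmult_integral_contrapositive_currified.
Qed.

Lemma rad_continuous (c : R -> pt) (t : R) : C1_curve c -> continuous (fun s => rad (c s)) t.
Proof.
intros Hc. destruct (curve_vel_is_derive c t Hc) as [HX HY].
apply is_derive_continuous in HX, HY.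
apply continuous_sqrt_comp.
apply (continuous_plus (V := R_NormedModule) (fun s => fst (c s) * fst (c s)) (fun s => snd (c s) * snd (c s)));
  apply (continuous_mult (K := R_AbsRing)); auto.
Qed.

(* [m r / r], with its limit [1] in place of the junk value at [r = 0]. *)
Definition slope (m : R -> R) (r : R) : R :=
  match Req_EM_T r 0 with left _ => 1 | right _ => m r / r end.

Lemma slope_mult (m : R -> R) (r : R) : m 0 = 0 -> slope m r * r = m r.
Proof.
intros H; unfold slope; destruct Req_EM_T as [-> | H0]; [rewrite H; ring | field; auto].
Qed.

(** The Euclidean square is dr^2 + r^2 dtheta^2, and the metric has the coefficient m^2 = slope^2
    r^2 instead. Unlike [gdot_polar], this form includes the origin, where the correction
    vanishes. *)
Lemma gdot_slope (m : R -> R) (p u : pt) :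
  m 0 = 0 ->
  gdot m p u u = eucl_dot u u + ((slope m (rad p)) ^ 2 - 1) * (rad p * angular p u) ^ 2.
Proof.
intros H. destruct (Req_EM_T (rad p) 0) as [E | E].
- unfold gdot, slope; destruct Req_EM_T; [| easy]. ring.
- rewrite gdot_polar by auto. rewrite <- (radial_angular_sqr p u) by auto.
  rewrite <- (slope_mult m (rad p)) at 1 by auto. ring.
Qed.

Lemma angular_le (p u : pt) : (rad p * angular p u) ^ 2 <= eucl_dot u u.
Proof.
destruct (Req_EM_T (rad p) 0) as [E | E].
- rewrite E. unfold eucl_dot. nra.
- rewrite <- (radial_angular_sqr p u) by auto. pose proof (pow2_ge_0 (radial p u)). lra.
Qed.

Lemma gnorm_ge_0 (m : R -> R) (p u : pt) : 0 <= gnorm m p u.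
Proof. apply sqrt_pos. Qed.

Lemma profile_continuous (m : R -> R) (r : R) : profile m -> continuous m r.
Proof. intros [H _]. apply (ex_derive_continuous (V := R_NormedModule)), (H 1%nat). Qed.

Lemma profile_is_derive (m : R -> R) (r : R) : profile m -> is_derive m r (Derive m r).
Proof. intros [H _]. apply Derive_correct, (H 1%nat). Qed.

Lemma profile_0 (m : R -> R) : profile m -> m 0 = 0.
Proof. intros H; apply H. Qed.

Lemma slope_continuous (m : R -> R) (r : R) : profile m -> continuous (slope m) r.
Proof.
intros Hm. destruct (Req_EM_T r 0) as [-> | Hr].
- assert (H := proj1 (proj2 (proj2 (proj2 Hm)))).
  apply is_derive_Reals in H.
  apply filterlim_locally. intros eps. destruct (H eps (cond_pos eps)) as [d Hd].
  exists d. intros h Hh.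
  assert (Hh' : Rabs h < d).
  { replace h with (h - 0) by ring. exact Hh. }
  change (Rabs (slope m h - slope m 0) < eps). unfold slope at 2.
  destruct (Req_EM_T 0 0) as [_ | n]; [| easy]. unfold slope.
  destruct Req_EM_T as [E | E]; [rewrite Rminus_diag, Rabs_R0; apply cond_pos |].
  specialize (Hd h E Hh').
  rewrite Rplus_0_l, (profile_0 m Hm), Rminus_0_r in Hd. exact Hd.
- apply (continuous_ext_loc _ (fun s => m s * / s)).
  + assert (Hpos : 0 < Rabs r) by now apply Rabs_pos_lt.
    exists (mkposreal _ Hpos). intros s Hs. unfold slope.
    destruct Req_EM_T as [-> | _]; [| reflexivity].
    exfalso. change (Rabs (0 - r) < Rabs r) in Hs.
    rewrite Rminus_0_l, Rabs_Ropp in Hs. lra.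
  + apply (continuous_mult (K := R_AbsRing)); [now apply profile_continuous |].
    now apply continuous_Rinv.
Qed.

Lemma gnorm_continuous (m : R -> R) (c : R -> pt) (t : R) :
  profile m -> C1_curve c -> continuous (fun s => gnorm m (c s) (curve_vel c s)) t.
Proof.
intros Hm Hc. apply continuous_sqrt_comp.
apply (continuous_ext (fun s => eucl_dot (curve_vel c s) (curve_vel c s) +
  ((slope m (rad (c s))) ^ 2 - 1) * (rad (c s) * angular (c s) (curve_vel c s)) ^ 2)).
{ intros s; symmetry; apply gdot_slope, Hm. }
destruct (proj2 Hc t) as [Hu1 Hu2].
destruct (curve_vel_is_derive c t Hc) as [HX HY].
apply is_derive_continuous in HX, HY.
assert (Hr := rad_continuous c t Hc).
assert (HE : continuous (fun s => eucl_dot (curve_vel c s) (curve_vel c s)) t).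
{ apply (continuous_plus (V := R_NormedModule)
    (fun s => fst (curve_vel c s) * fst (curve_vel c s)) (fun s => snd (curve_vel c s) * snd (curve_vel c s)));
  apply (continuous_mult (K := R_AbsRing)); auto. }
assert (HS : continuous (fun s => (slope m (rad (c s))) ^ 2 - 1) t).
{ assert (H := continuous_comp (fun s => rad (c s)) (slope m) t Hr (slope_continuous m _ Hm)).
  apply (continuous_ext (fun s => slope m (rad (c s)) * slope m (rad (c s)) - 1)); [intros; simpl; ring |].
  apply (continuous_minus (V := R_NormedModule) (fun s => slope m (rad (c s)) * slope m (rad (c s))) (fun _ => 1));
  [apply (continuous_mult (K := R_AbsRing)); auto | apply continuous_const]. }
apply (continuous_plus (V := R_NormedModule)
  (fun s => eucl_dot (curve_vel c s) (curve_vel c s))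
  (fun s => ((slope m (rad (c s))) ^ 2 - 1) * (rad (c s) * angular (c s) (curve_vel c s)) ^ 2)); [exact HE |].
destruct (Req_EM_T (rad (c t)) 0) as [E | E].
(* [angular] need not have a limit at the origin. By [angular_le] the correction is dominated by
   slope^2 - 1 times the Euclidean square of the velocity, which tends to 0. *)
- assert (HP : continuous (fun s => ((slope m (rad (c s))) ^ 2 - 1) * eucl_dot (curve_vel c s) (curve_vel c s)) t)
    by (apply (continuous_mult (K := R_AbsRing)); auto).
  apply filterlim_locally. intros eps.
  assert (HP' := proj1 (filterlim_locally _ _) HP eps).
  revert HP'. apply filter_imp. intros s.
  assert (E1 : slope m (rad (c t)) = 1).
  { unfold slope; destruct Req_EM_T; easy. }
  set (k := slope m (rad (c s)) ^ 2 - 1).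
  set (w := eucl_dot (curve_vel c s) (curve_vel c s)).
  set (b := (rad (c s) * angular (c s) (curve_vel c s)) ^ 2).
  change (Rabs (k * w - ((slope m (rad (c t)) ^ 2 - 1) * eucl_dot (curve_vel c t) (curve_vel c t))) < eps ->
    Rabs (k * b - ((slope m (rad (c t)) ^ 2 - 1) * (rad (c t) * angular (c t) (curve_vel c t)) ^ 2)) < eps).
  rewrite E1. replace (1 ^ 2 - 1) with 0 by ring. rewrite !Rmult_0_l, !Rminus_0_r, !Rabs_mult.
  intros H. eapply Rle_lt_trans; [| exact H].
  apply Rmult_le_compat_l; [apply Rabs_pos |].
  pose proof (angular_le (c s) (curve_vel c s)) as H1. fold b w in H1.
  assert (0 <= b) by apply pow2_ge_0.
  rewrite !Rabs_pos_eq; lra.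
- apply (continuous_mult (K := R_AbsRing)); [exact HS |].
  assert (HA : continuous (fun s => rad (c s) * angular (c s) (curve_vel c s)) t).
  { apply (continuous_mult (K := R_AbsRing)); [exact Hr |].
    apply (continuous_mult (K := R_AbsRing)
      (fun s => fst (c s) * snd (curve_vel c s) - snd (c s) * fst (curve_vel c s)) (fun s => / (rad (c s)) ^ 2)).
    - apply (continuous_minus (V := R_NormedModule)
        (fun s => fst (c s) * snd (curve_vel c s)) (fun s => snd (c s) * fst (curve_vel c s)));
      apply (continuous_mult (K := R_AbsRing)); auto.
    - apply (continuous_comp (fun s => rad (c s)) (fun r => / r ^ 2)); [exact Hr |].
      apply (is_derive_continuous _ _ (- 2 / (rad (c t)) ^ 3)).
      auto_derive; [rewrite Rmult_1_r; now apply Rmult_integral_contrapositive_currified | field; exact E]. }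
  apply (continuous_ext (fun s => (rad (c s) * angular (c s) (curve_vel c s)) * (rad (c s) * angular (c s) (curve_vel c s))));
    [intros; simpl; ring |].
  apply (continuous_mult (K := R_AbsRing)); auto.
Qed.

Lemma increment_le_length (m : R -> R) (c : R -> pt) (f : R -> R) (T : R) :
  profile m -> C1_curve c -> 0 <= T <= 1 ->
  (forall t, 0 <= t <= T -> exists l, is_derive f t l /\ Rabs l <= gnorm m (c t) (curve_vel c t)) ->
  Rabs (f T - f 0) <= curve_length m c.
Proof.
intros Hm Hc HT Hf.
set (g := fun t => gnorm m (c t) (curve_vel c t)).
assert (Hg : forall t, continuous g t) by (intros; now apply gnorm_continuous).
assert (Hex : forall a b, ex_RInt g a b).
{ intros; apply (ex_RInt_continuous (V := R_CompleteNormedModule)); auto. }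
apply Rle_trans with (RInt g 0 T); [apply increment_le_RInt; auto; lra |].
unfold curve_length. fold g.
rewrite <- (RInt_Chasles (V := R_CompleteNormedModule) g 0 T 1) by auto.
assert (0 <= RInt g T 1).
{ apply RInt_ge_0; [lra | auto |]. intros; apply gnorm_ge_0. }
unfold plus; simpl; lra.
Qed.

Lemma Rabs_radial_le (m : R -> R) (p u : pt) : rad p <> 0 -> Rabs (radial p u) <= gnorm m p u.
Proof.
intros Hp. rewrite gnorm_polar by auto. rewrite <- sqrt_Rsqr_abs.
apply sqrt_le_1_alt. unfold Rsqr. nra.
Qed.

(* The distance [rad] to the origin is smoothed to [sqrt (rad^2 + e^2)], since it is not differentiable at the origin. *)
Lemma rad_increment_le_length (m : R -> R) (c : R -> pt) (T : R) :
  profile m -> C1_curve c -> 0 <= T <= 1 ->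
  Rabs (rad (c T) - rad (c 0)) <= curve_length m c.
Proof.
intros Hm Hc HT. apply Rnot_lt_le; intros Hlt.
(* Half of the supposed excess: [f] lies between [rad] and [rad + e], so the increment of [rad] can
   exceed the length by at most [e], not by [2 * e]. *)
set (e := (Rabs (rad (c T) - rad (c 0)) - curve_length m c) / 2).
assert (He : 0 < e) by (unfold e; lra).
set (f := fun t => sqrt (fst (c t) * fst (c t) + snd (c t) * snd (c t) + e * e)).
assert (Hrf : forall t, rad (c t) <= f t <= rad (c t) + e).
{ intros t. pose proof (rad_ge_0 (c t)) as Hr0. unfold f. rewrite <- rad_sqr.
  assert (Hsq : 0 <= rad (c t) * rad (c t) + e * e) by nra.
  pose proof (sqrt_pos (rad (c t) * rad (c t) + e * e)). pose proof (sqrt_sqrt _ Hsq). nra. }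
assert (H : Rabs (f T - f 0) <= curve_length m c).
{ apply increment_le_length; auto. intros t Ht.
  destruct (curve_vel_is_derive c t Hc) as [HX HY].
  assert (Hpos : 0 < fst (c t) * fst (c t) + snd (c t) * snd (c t) + e * e) by nra.
  exists (eucl_dot (c t) (curve_vel c t) / f t). split.
  - assert (Hf0 : 0 < f t) by (now apply sqrt_lt_R0).
    evar_last.
    + apply (is_derive_sqrt (fun t => fst (c t) * fst (c t) + snd (c t) * snd (c t) + e * e)); [| exact Hpos].
      apply (is_derive_plus (V := R_NormedModule)
        (fun s => fst (c s) * fst (c s) + snd (c s) * snd (c s)) (fun _ => e * e)); [| apply (is_derive_const (V := R_NormedModule))].
      apply (is_derive_plus (V := R_NormedModule) (fun s => fst (c s) * fst (c s)) (fun s => snd (c s) * snd (c s))).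
      * apply (is_derive_mult (K := R_AbsRing) (fun s => fst (c s)) (fun s => fst (c s))); eauto. intros; apply Rmult_comm.
      * apply (is_derive_mult (K := R_AbsRing) (fun s => snd (c s)) (fun s => snd (c s))); eauto. intros; apply Rmult_comm.
    + unfold plus, mult, zero, eucl_dot; simpl. unfold plus; simpl. fold (f t). field. lra.
  - assert (Hf0 : 0 < f t) by (now apply sqrt_lt_R0).
    destruct (Req_EM_T (rad (c t)) 0) as [E | E].
    + assert (fst (c t) = 0 /\ snd (c t) = 0) as [E1 E2].
      { pose proof (rad_sqr (c t)) as H. rewrite E in H. split; nra. }
      unfold eucl_dot. rewrite E1, E2, !Rmult_0_l, Rplus_0_l. unfold Rdiv. rewrite Rmult_0_l, Rabs_R0.
      apply gnorm_ge_0.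
    + apply Rle_trans with (2 := Rabs_radial_le m (c t) (curve_vel c t) E).
      unfold radial, Rdiv. rewrite !Rabs_mult.
      apply Rmult_le_compat_l; [apply Rabs_pos |].
      pose proof (rad_ge_0 (c t)).
      rewrite !Rabs_pos_eq by (left; apply Rinv_0_lt_compat; lra).
      apply Rinv_le_contravar; [lra | apply Hrf]. }
pose proof (Hrf T); pose proof (Hrf 0).
assert (HH : Rabs (rad (c T) - rad (c 0)) <= Rabs (f T - f 0) + e).
{ unfold Rabs; repeat destruct Rcase_abs; lra. }
unfold e in HH, He. lra.
Qed.

(** * Functions that bound the distance from below *)

Lemma gdist_le_length (m : R -> R) (c : R -> pt) (x : R) :
  C1_curve c -> gdist m (c 0) (c 1) = Finite x -> x <= curve_length m c.
Proof.
intros Hc Hx. unfold gdist in Hx.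
match type of Hx with Glb_Rbar ?E = _ => destruct (Glb_Rbar_correct E) as [H _] end.
rewrite Hx in H. apply (H (curve_length m c)). exists c; auto.
Qed.

Lemma gdist_short_curve (m : R -> R) (p q : pt) (x b : R) :
  gdist m p q = Finite x -> x < b ->
  exists c, C1_curve c /\ c 0 = p /\ c 1 = q /\ curve_length m c < b.
Proof.
intros Hx Hb. unfold gdist in Hx.
match type of Hx with Glb_Rbar ?E = _ => destruct (Glb_Rbar_correct E) as [_ H] end.
rewrite Hx in H.
apply Classical_Prop.NNPP. intros Hn.
assert (Hlb : Rbar_le b x); [| simpl in Hlb; lra].
apply H. intros L (c & H1 & H2 & H3 & ->). simpl.
apply Rnot_lt_le. intros Hlt. apply Hn. exists c; auto.
Qed.

(** A curve of length below [d] changes [rad] by less than [d], so [W] has to be tested only on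
    curves in an annulus about the circle through [p]. This is how knowledge of [m] on a bounded
    interval suffices. *)
Lemma increment_le_gdist (m : R -> R) (W : pt -> R) (p q : pt) (x d : R) :
  profile m -> gdist m p q = Finite x -> x < d ->
  (forall c, C1_curve c -> c 0 = p -> c 1 = q ->
    (forall t, 0 <= t <= 1 -> Rabs (rad (c t) - rad p) < d) ->
    Rabs (W (c 1) - W (c 0)) <= curve_length m c) ->
  Rabs (W q - W p) <= x.
Proof.
intros Hm Hx Hd HW. apply Rnot_lt_le; intros Hlt.
destruct (gdist_short_curve m p q x (Rmin d (Rabs (W q - W p))) Hx) as (c & Hc & H0 & H1 & HL).
{ now apply Rmin_glb_lt. }
assert (HL1 := Rlt_le_trans _ _ _ HL (Rmin_l _ _)).
assert (HL2 := Rlt_le_trans _ _ _ HL (Rmin_r _ _)).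
apply Rlt_not_le with (1 := HL2).
rewrite <- H0, <- H1. apply HW; auto.
intros t Ht. rewrite <- H0. eapply Rle_lt_trans; [now apply (rad_increment_le_length m) | exact HL1].
Qed.

Lemma rad_increment_le_gdist (m : R -> R) (p q : pt) (x : R) :
  profile m -> gdist m p q = Finite x -> Rabs (rad q - rad p) <= x.
Proof.
intros Hm Hx. apply (increment_le_gdist m rad p q x (x + 1)); auto; [lra |].
intros c Hc _ _ _. apply rad_increment_le_length; auto; lra.
Qed.

(** At a zero of [g] the product rule asks only continuity of [f]. It is applied to [flat] at the
    origin, with [slope] as the merely continuous factor. *)
Lemma is_derive_mult_zero (f g : R -> R) (t d : R) :
  continuous f t -> is_derive g t d -> g t = 0 ->
  is_derive (fun s => f s * g s) t (f t * d).
Proof.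
intros Hf Hg H0. apply is_derive_Reals. intros eps Heps.
assert (HB : 0 < Rabs (f t) + 1) by (pose proof (Rabs_pos (f t)); lra).
assert (HD : 0 < Rabs d + 1) by (pose proof (Rabs_pos d); lra).
assert (H1 : 0 < eps / (2 * (Rabs (f t) + 1))) by (apply Rdiv_lt_0_compat; lra).
assert (H2 : 0 < Rmin 1 (eps / (2 * (Rabs d + 1)))).
{ apply Rmin_glb_lt; [lra | apply Rdiv_lt_0_compat; lra]. }
apply is_derive_Reals in Hg. destruct (Hg _ H1) as [d1 Hd1].
destruct (proj1 (filterlim_locally _ _) Hf (mkposreal _ H2)) as [d2 Hd2].
assert (H3 : 0 < Rmin d1 d2) by (apply Rmin_glb_lt; apply cond_pos).
exists (mkposreal _ H3). intros h Hh Hlt. simpl in Hlt.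
specialize (Hd1 h Hh (Rlt_le_trans _ _ _ Hlt (Rmin_l _ _))).
assert (Hb : Rabs (f (t + h) - f t) < Rmin 1 (eps / (2 * (Rabs d + 1)))).
{ apply (Hd2 (t + h)). change (Rabs (t + h - t) < d2). replace (t + h - t) with h by ring.
  apply (Rlt_le_trans _ _ _ Hlt (Rmin_r _ _)). }
assert (Hb1 := Rlt_le_trans _ _ _ Hb (Rmin_l _ _)).
assert (Hb2 := Rlt_le_trans _ _ _ Hb (Rmin_r _ _)).
rewrite H0, Rminus_0_r in Hd1. rewrite H0, Rmult_0_r, Rminus_0_r.
replace (f (t + h) * g (t + h) / h - f t * d)
  with (f (t + h) * (g (t + h) / h - d) + (f (t + h) - f t) * d) by (field; auto).
eapply Rle_lt_trans; [apply Rabs_triang |]. rewrite !Rabs_mult.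
assert (Hf1 : Rabs (f (t + h)) <= Rabs (f t) + 1).
{ replace (f (t + h)) with ((f (t + h) - f t) + f t) by ring.
  eapply Rle_trans; [apply Rabs_triang | lra]. }
assert (A1 : Rabs (f (t + h)) * Rabs (g (t + h) / h - d) < eps / 2).
{ apply Rle_lt_trans with ((Rabs (f t) + 1) * Rabs (g (t + h) / h - d)).
  - apply Rmult_le_compat_r; [apply Rabs_pos | exact Hf1].
  - replace (eps / 2) with ((Rabs (f t) + 1) * (eps / (2 * (Rabs (f t) + 1)))) by (field; lra).
    now apply Rmult_lt_compat_l. }
assert (A2 : Rabs (f (t + h) - f t) * Rabs d <= eps / 2).
{ apply Rle_trans with ((eps / (2 * (Rabs d + 1))) * (Rabs d + 1)).
  - apply Rmult_le_compat; try apply Rabs_pos; lra.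
  - right; field; lra. }
lra.
Qed.

(* The inner product with [u] of the image of [p] under the map (r, theta) |-> (m r, theta) to the flat plane in polar
   coordinates; that map does not increase lengths where |m'| <= 1. *)
Definition flat (m : R -> R) (u p : pt) : R := slope m (rad p) * eucl_dot p u.

Lemma slope_is_derive (m : R -> R) (r : R) :
  profile m -> r <> 0 -> is_derive (slope m) r ((Derive m r * r - m r) / r ^ 2).
Proof.
intros Hm Hr. apply (is_derive_ext_loc (fun s => m s / s)).
- assert (Hpos : 0 < Rabs r) by now apply Rabs_pos_lt.
  exists (mkposreal _ Hpos). intros s Hs. unfold slope.
  destruct Req_EM_T as [-> | _]; [| reflexivity].
  exfalso. change (Rabs (0 - r) < Rabs r) in Hs.
  rewrite Rminus_0_l, Rabs_Ropp in Hs. lra.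
- evar_last; [apply (is_derive_div m (fun s => s)) |].
  + now apply profile_is_derive.
  + apply (is_derive_id (K := R_AbsRing)).
  + exact Hr.
  + unfold one; simpl. field. exact Hr.
Qed.

Lemma eucl_dot_is_derive (c : R -> pt) (u : pt) (t : R) :
  C1_curve c -> is_derive (fun s => eucl_dot (c s) u) t (eucl_dot (curve_vel c t) u).
Proof.
intros Hc. destruct (curve_vel_is_derive c t Hc) as [HX HY].
apply (is_derive_plus (V := R_NormedModule) (fun s => fst (c s) * fst u) (fun s => snd (c s) * snd u)).
- apply (is_derive_ext (fun s => fst u * fst (c s))); [intros; apply Rmult_comm |].
  rewrite Rmult_comm. now apply is_derive_scal.
- apply (is_derive_ext (fun s => snd u * snd (c s))); [intros; apply Rmult_comm |].
  rewrite Rmult_comm. now apply is_derive_scal.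
Qed.

(** In polar coordinates [flat m u] is m(r) cos (theta - theta_u), with differential m' cos dr - m
    sin dtheta; Cauchy-Schwarz and |m'| <= 1 bound it by the norm of (dr, m dtheta). *)
Lemma flat_increment_le_length (m : R -> R) (c : R -> pt) (u : pt) :
  profile m -> C1_curve c -> eucl_dot u u = 1 ->
  (forall t, 0 <= t <= 1 -> rad (c t) <> 0 -> Rabs (Derive m (rad (c t))) <= 1) ->
  Rabs (flat m u (c 1) - flat m u (c 0)) <= curve_length m c.
Proof.
intros Hm Hc Hu Hd. apply (increment_le_length m c (fun t => flat m u (c t)) 1); auto; [lra |].
intros t Ht. set (p := c t). set (v := curve_vel c t).
destruct (Req_EM_T (rad p) 0) as [E | E].
- exists (slope m (rad p) * eucl_dot v u). split.
  + apply (is_derive_mult_zero (fun s => slope m (rad (c s))) (fun s => eucl_dot (c s) u)).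
    * apply (continuous_comp (fun s => rad (c s)) (slope m)).
      -- now apply rad_continuous.
      -- now apply slope_continuous.
    * now apply eucl_dot_is_derive.
    * fold p. pose proof (rad_sqr p) as H. rewrite E in H.
      assert (fst p = 0 /\ snd p = 0) as [E1 E2] by (split; nra).
      unfold eucl_dot. rewrite E1, E2. ring.
  + rewrite gnorm_origin by auto. rewrite E. unfold slope. destruct Req_EM_T; [| easy].
    rewrite Rmult_1_l. unfold eucl_norm, eucl_dot in *.
    eapply Rle_trans; [apply Rabs_dot_le |].
    replace (fst u ^ 2 + snd u ^ 2) with 1 by (rewrite <- Hu; ring).
    rewrite sqrt_1, Rmult_1_r. apply sqrt_le_1_alt. lra.
- exists (radial p v * ((Derive m (rad p) * rad p - m (rad p)) / (rad p) ^ 2) * eucl_dot p u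
          + slope m (rad p) * eucl_dot v u). split.
  + apply (is_derive_mult (K := R_AbsRing) (fun s => slope m (rad (c s))) (fun s => eucl_dot (c s) u)).
    * apply (is_derive_comp (slope m) (fun s => rad (c s))).
      -- now apply slope_is_derive.
      -- now apply rad_is_derive.
    * now apply eucl_dot_is_derive.
    * intros; apply Rmult_comm.
  + rewrite gnorm_polar by auto.
    pose proof (rad_sqr p) as HR. specialize (Hd t Ht E). fold p in Hd.
    replace (_ + _) with ((Derive m (rad p) * radial p v) * (eucl_dot p u / rad p)
      + (m (rad p) * angular p v) * ((fst p * snd u - snd p * fst u) / rad p)).
    * eapply Rle_trans; [apply Rabs_dot_le |].
      replace ((eucl_dot p u / rad p) ^ 2 + ((fst p * snd u - snd p * fst u) / rad p) ^ 2)
        with ((eucl_dot u u) * ((fst p * fst p + snd p * snd p) / (rad p * rad p)))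
        by (unfold eucl_dot; field; auto).
      rewrite Hu, <- HR.
      replace (1 * (rad p * rad p / (rad p * rad p))) with 1 by (field; auto).
      rewrite sqrt_1, Rmult_1_r. apply sqrt_le_1_alt.
      apply Rplus_le_compat_r. rewrite Rpow_mult_distr.
      apply Rabs_le_between in Hd.
      assert (Derive m (rad p) ^ 2 <= 1) by nra.
      pose proof (pow2_ge_0 (radial p v)). nra.
    * unfold slope. destruct Req_EM_T; [easy |].
      unfold radial, angular.
      (* The inner product of [v] and [u], expanded in the orthogonal frame of [p] and its rotation
         by a right angle. *)
      assert (Hv : eucl_dot v u * (rad p * rad p) = eucl_dot p v * eucl_dot p u
        + (fst p * snd v - snd p * fst v) * (fst p * snd u - snd p * fst u)).
      { rewrite HR. unfold eucl_dot. ring. }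
      replace (eucl_dot v u) with ((eucl_dot p v * eucl_dot p u
        + (fst p * snd v - snd p * fst v) * (fst p * snd u - snd p * fst u)) / (rad p * rad p))
        by (rewrite <- Hv; field; auto).
      field. exact E.
Qed.

Lemma is_derive_acos (x : R) : -1 < x < 1 -> is_derive acos x (-1 / sqrt (1 - x ^ 2)).
Proof.
intros Hx. apply is_derive_Reals.
apply (derive_pt_eq_1 _ _ _ (derivable_pt_acos x Hx)). rewrite derive_pt_acos.
unfold Rsqr. simpl. now rewrite Rmult_1_r.
Qed.

(** For a unit vector [w], [acos (cosine w p)] is the unsigned angle at the origin between [w] and
    [p]. *)
Definition cosine (w p : pt) : R := eucl_dot p w / rad p.

Lemma cosine_sqr (w p : pt) :
  eucl_dot w w = 1 -> rad p <> 0 ->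
  (cosine w p) ^ 2 + ((fst p * snd w - snd p * fst w) / rad p) ^ 2 = 1.
Proof.
intros Hw Hp. pose proof (rad_sqr p) as HR. unfold cosine, eucl_dot in *.
apply Rmult_eq_reg_r with (rad p * rad p); [| now apply Rmult_integral_contrapositive_currified].
transitivity ((fst w * fst w + snd w * snd w) * (fst p * fst p + snd p * snd p)).
- field. exact Hp.
- rewrite Hw, HR. ring.
Qed.

Lemma cosine_bound (w p : pt) : eucl_dot w w = 1 -> rad p <> 0 -> -1 <= cosine w p <= 1.
Proof.
intros Hw Hp. pose proof (cosine_sqr w p Hw Hp).
pose proof (pow2_ge_0 ((fst p * snd w - snd p * fst w) / rad p)). nra.
Qed.

(* The factor [k < 1] keeps [acos] away from its singularities at the two half-lines spanned by [w]. *)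
Definition clairaut (e k : R) (H : R -> R) (w p : pt) : R :=
  e * acos (k * cosine w p) - H (rad p).

(* By Cauchy-Schwarz, as (e / m)^2 + (1 - (e / m)^2) = 1. *)
Lemma clairaut_increment_le_length (m H : R -> R) (c : R -> pt) (e k : R) (w : pt) :
  profile m -> C1_curve c -> eucl_dot w w = 1 -> 0 <= e -> 0 <= k < 1 ->
  (forall t, 0 <= t <= 1 -> 0 < rad (c t) /\ e <= m (rad (c t)) /\
    is_derive H (rad (c t)) (sqrt (1 - (e / m (rad (c t))) ^ 2))) ->
  Rabs (clairaut e k H w (c 1) - clairaut e k H w (c 0)) <= curve_length m c.
Proof.
intros Hm Hc Hw He Hk Hd.
apply (increment_le_length m c (fun t => clairaut e k H w (c t)) 1); auto; [lra |].
intros t Ht. destruct (Hd t Ht) as (Hr & Hem & HH). clear Hd.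
set (p := c t) in *. set (v := curve_vel c t).
assert (E : rad p <> 0) by lra.
pose proof (cosine_bound w p Hw E) as HD. pose proof (cosine_sqr w p Hw E) as HDG.
set (D := cosine w p) in *. set (G := (fst p * snd w - snd p * fst w) / rad p) in *.
set (M := m (rad p)) in *.
assert (HM : 0 < M) by now apply Hm.
assert (HkD : -1 < k * D < 1) by nra.
assert (HS : 0 < 1 - (k * D) ^ 2) by nra.
pose proof (sqrt_lt_R0 _ HS) as HS'. pose proof (sqrt_sqrt _ (Rlt_le _ _ HS)) as HSS.
set (S := sqrt (1 - (k * D) ^ 2)) in *.
exists (e * (k * (angular p v * G) * (-1 / S)) - radial p v * sqrt (1 - (e / M) ^ 2)). split.
- apply (is_derive_minus (V := R_NormedModule)
    (fun s => e * acos (k * cosine w (c s))) (fun s => H (rad (c s)))).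
  + apply (is_derive_scal (fun s => acos (k * cosine w (c s)))).
    apply (is_derive_comp acos (fun s => k * cosine w (c s))).
    * now apply is_derive_acos.
    * apply (is_derive_scal (fun s => cosine w (c s))).
      evar_last.
      -- apply (is_derive_div (fun s => eucl_dot (c s) w) (fun s => rad (c s))); [now apply eucl_dot_is_derive | now apply rad_is_derive | exact E].
      -- fold p v. unfold G, angular, radial.
         pose proof (rad_sqr p) as HR.
         assert (Hv : eucl_dot v w * (rad p * rad p) = eucl_dot p v * eucl_dot p w
           + (fst p * snd v - snd p * fst v) * (fst p * snd w - snd p * fst w)).
         { rewrite HR. unfold eucl_dot. ring. }
         replace (eucl_dot v w) with ((eucl_dot p v * eucl_dot p w
           + (fst p * snd v - snd p * fst v) * (fst p * snd w - snd p * fst w)) / (rad p * rad p))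
           by (rewrite <- Hv; field; auto).
         field. exact E.
  + apply (is_derive_comp H (fun s => rad (c s))); [exact HH | now apply rad_is_derive].
- rewrite gnorm_polar by auto. fold M.
  replace (_ - _) with ((- sqrt (1 - (e / M) ^ 2)) * radial p v + (- (e / M) * (k * G / S)) * (M * angular p v))
    by (field; split; lra).
  eapply Rle_trans; [apply Rabs_dot_le |].
  assert (HeM : 0 <= e / M <= 1).
  { split; [apply Rmult_le_pos; [lra | left; now apply Rinv_0_lt_compat] |].
    apply Rmult_le_reg_r with M; [lra |]. unfold Rdiv. rewrite Rmult_assoc, Rinv_l; lra. }
  (* k^2 (1 - D^2) <= 1 - k^2 D^2: the damped angle still changes at rate at most 1 in theta. *)
  assert (HkG : (k * G / S) ^ 2 <= 1).
  { apply Rmult_le_reg_r with (S * S); [nra |].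
    replace ((k * G / S) ^ 2 * (S * S)) with ((k * G) ^ 2) by (field; lra).
    rewrite Rmult_1_l, HSS. rewrite !Rpow_mult_distr.
    replace (G ^ 2) with (1 - D ^ 2) by lra. nra. }
  rewrite <- (Rmult_1_l (sqrt (radial p v ^ 2 + _))) at 2.
  apply Rmult_le_compat_r; [apply sqrt_pos |].
  rewrite <- sqrt_1 at 2. apply sqrt_le_1_alt.
  replace ((- sqrt (1 - (e / M) ^ 2)) ^ 2) with (sqrt (1 - (e / M) ^ 2) * sqrt (1 - (e / M) ^ 2)) by ring.
  rewrite sqrt_sqrt by nra. rewrite Rpow_mult_distr.
  replace ((- (e / M)) ^ 2) with ((e / M) ^ 2) by ring.
  pose proof (pow2_ge_0 (e / M)). nra.
Qed.

(** * Turning angle and length of outward geodesics *)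

Lemma is_derive_asin (x : R) : -1 < x < 1 -> is_derive asin x (1 / sqrt (1 - x ^ 2)).
Proof.
intros Hx. apply is_derive_Reals.
apply (derive_pt_eq_1 _ _ _ (derivable_pt_asin x Hx)). rewrite derive_pt_asin.
unfold Rsqr. simpl. now rewrite Rmult_1_r.
Qed.

Lemma sqrt_one_minus_div (e s : R) : 0 < s -> 0 <= e < s -> sqrt (1 - (e / s) ^ 2) = sqrt (s ^ 2 - e ^ 2) / s.
Proof.
intros Hs He. replace (1 - (e / s) ^ 2) with ((s ^ 2 - e ^ 2) / s ^ 2) by (field; lra).
rewrite sqrt_div by nra. f_equal. apply sqrt_pow2; lra.
Qed.

Lemma div_lt_1 (e s : R) : 0 <= e < s -> 0 <= e / s < 1.
Proof.
intros He. split.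
- apply Rmult_le_pos; [lra | left; apply Rinv_0_lt_compat; lra].
- apply Rmult_lt_reg_r with s; [lra |]. unfold Rdiv. rewrite Rmult_assoc, Rinv_l; lra.
Qed.

Lemma asin_ge_0 (x : R) : 0 <= x <= 1 -> 0 <= asin x.
Proof.
intros Hx. apply Rnot_lt_le; intros Hlt.
pose proof (asin_bound x). pose proof PI_RGT_0.
assert (sin (asin x) < 0) by (apply sin_lt_0_var; lra).
rewrite sin_asin in H1; lra.
Qed.

Lemma asin_ge (x : R) : 0 <= x <= 1 -> x <= asin x.
Proof.
intros Hx. pose proof (asin_ge_0 x Hx). pose proof (sin_asin x ltac:(lra)).
destruct (Rle_lt_or_eq_dec _ _ H) as [H1 | H1]; [pose proof (sin_lt_x _ H1); lra |].
rewrite <- H1, sin_0 in H0. lra.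
Qed.

(** Strict concavity of [cos] on [[0, PI / 2]]: the graph lies below its tangent at [x]. *)
Lemma cos_tangent_lt (x y : R) : 0 <= x < y -> y <= PI / 2 -> cos y < cos x - (y - x) * sin x.
Proof.
intros Hx Hy.
destruct (MVT_cor2 cos (fun x => - sin x) x y) as (z & Hz1 & Hz2); [lra | intros; apply derivable_pt_lim_cos |].
assert (sin x < sin z) by (apply sin_increasing_1; lra). nra.
Qed.

(** In essence x < tan x, read off from the tangent of [cos] at [PI / 2 - x], evaluated at
    [PI / 2]. *)
Lemma mul_cos_lt_sin (x : R) : 0 < x <= PI / 2 -> x * cos x < sin x.
Proof.
intros Hx. pose proof (cos_tangent_lt (PI / 2 - x) (PI / 2) ltac:(lra) ltac:(lra)) as H.
rewrite cos_PI2, cos_shift, sin_shift in H. lra.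
Qed.

(** With t = asin x, [mul_cos_lt_sin] gives t cos t < x for x > 0, and cos t >= 1/2 on this range.
    This crude constant is the reason for the 2 in [Hratio]. *)
Lemma asin_le_double (x : R) : 0 <= x <= 1 / 2 -> asin x <= 2 * x.
Proof.
intros Hx. destruct (Rle_lt_or_eq_dec 0 x ltac:(lra)) as [H0 | <-]; [| rewrite asin_0; lra].
pose proof (asin_ge x ltac:(lra)). pose proof (asin_bound x).
pose proof (mul_cos_lt_sin (asin x) ltac:(lra)) as Ht.
rewrite sin_asin in Ht by lra. rewrite cos_asin in Ht by lra.
assert (1 / 2 <= sqrt (1 - Rsqr x)).
{ rewrite <- (sqrt_pow2 (1 / 2)) by lra. apply sqrt_le_1_alt. unfold Rsqr. nra. }
nra.
Qed.

(* Primitive of [asin (e / s)] with respect to [e], and of [sqrt (1 - (e / s)^2)] with respect to [s]. *)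
Definition arc_primitive (s e : R) : R := sqrt (s ^ 2 - e ^ 2) + e * asin (e / s).

Lemma arc_primitive_derive_e (s e : R) :
  0 <= e < s -> is_derive (arc_primitive s) e (asin (e / s)).
Proof.
intros He. pose proof (div_lt_1 e s He) as Hd. assert (Hp : 0 < s ^ 2 - e ^ 2) by nra.
pose proof (sqrt_lt_R0 _ Hp).
evar_last.
- apply (is_derive_plus (V := R_NormedModule) (fun e => sqrt (s ^ 2 - e ^ 2)) (fun e => e * asin (e / s))).
  + apply (is_derive_sqrt (fun e => s ^ 2 - e ^ 2) e (- (2 * e))); [| exact Hp].
    auto_derive; [auto | ring].
  + apply (is_derive_mult (K := R_AbsRing) (fun e => e) (fun e => asin (e / s))).
    * apply (is_derive_id (K := R_AbsRing)).
    * apply (is_derive_comp asin (fun e => e / s)).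
      -- apply is_derive_asin; lra.
      -- apply (is_derive_ext (fun e => / s * e)); [intros; unfold Rdiv; apply Rmult_comm |].
         apply (is_derive_scal (fun e => e) e (/ s) 1), (is_derive_id (K := R_AbsRing)).
    * intros; apply Rmult_comm.
- rewrite sqrt_one_minus_div by lra.
  unfold plus, mult, scal, one; simpl. unfold mult; simpl.
  simpl in H. rewrite !Rmult_1_r in *. field. lra.
Qed.

Lemma arc_primitive_derive_s (s e : R) :
  0 <= e < s -> is_derive (fun s => arc_primitive s e) s (sqrt (1 - (e / s) ^ 2)).
Proof.
intros He. pose proof (div_lt_1 e s He) as Hd. assert (Hp : 0 < s ^ 2 - e ^ 2) by nra.
pose proof (sqrt_lt_R0 _ Hp).
evar_last.
- apply (is_derive_plus (V := R_NormedModule) (fun s => sqrt (s ^ 2 - e ^ 2)) (fun s => e * asin (e / s))).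
  + apply (is_derive_sqrt (fun s => s ^ 2 - e ^ 2) s (2 * s)); [| exact Hp].
    auto_derive; [auto | ring].
  + apply (is_derive_scal (fun s => asin (e / s))).
    apply (is_derive_comp asin (fun s => e / s)).
    * apply is_derive_asin; lra.
    * assert (is_derive (fun s => e / s) s (- e / s ^ 2)) as Hq; [| exact Hq].
      auto_derive; [lra | field; lra].
- rewrite sqrt_one_minus_div by lra.
  unfold plus, scal; simpl. unfold mult; simpl. simpl in H. rewrite !Rmult_1_r in *.
  pose proof (sqrt_sqrt (s * s - e * e) ltac:(lra)) as Hss.
  set (u := sqrt (s * s - e * e)) in *.
  apply Rmult_eq_reg_r with (u * s); [| apply Rmult_integral_contrapositive_currified; lra].
  transitivity (s * s - e * e); [field; lra | rewrite <- Hss; field; lra].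
Qed.

(** * Explicit curves that bound the distance from above *)

Lemma rad_lin_comb (a b : R) (p q : pt) :
  rad (a * fst p + b * fst q, a * snd p + b * snd q) <= Rabs a * rad p + Rabs b * rad q.
Proof.
pose proof (rad_ge_0 p). pose proof (rad_ge_0 q). pose proof (Rabs_pos a). pose proof (Rabs_pos b).
assert (Hn : 0 <= Rabs a * rad p + Rabs b * rad q) by nra.
apply Rsqr_incr_0_var; [| exact Hn]. unfold Rsqr. rewrite rad_sqr. cbn [fst snd].
pose proof (rad_sqr p) as Hp. pose proof (rad_sqr q) as Hq.
assert (Hpq : fst p * fst q + snd p * snd q <= rad p * rad q /\ - (fst p * fst q + snd p * snd q) <= rad p * rad q).
{ assert (Hd := Rabs_dot_le (fst p) (snd p) (fst q) (snd q)).
  replace (fst p ^ 2 + snd p ^ 2) with (rad p ^ 2) in Hd by (simpl; rewrite Rmult_1_r, Hp; ring).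
  replace (fst q ^ 2 + snd q ^ 2) with (rad q ^ 2) in Hd by (simpl; rewrite Rmult_1_r, Hq; ring).
  rewrite !sqrt_pow2 in Hd by auto. apply Rabs_le_between in Hd. lra. }
assert (Ha : Rabs a * Rabs a = a * a) by (rewrite <- Rabs_mult; apply Rabs_pos_eq; nra).
assert (Hb : Rabs b * Rabs b = b * b) by (rewrite <- Rabs_mult; apply Rabs_pos_eq; nra).
assert (Hab : a * b * (fst p * fst q + snd p * snd q) <= Rabs a * Rabs b * (rad p * rad q)).
{ rewrite <- Rabs_mult. pose proof (Rabs_pos (a * b)).
  destruct (Rle_lt_dec 0 (a * b)); [rewrite Rabs_pos_eq by lra | rewrite Rabs_left by lra]; nra. }
replace ((a * fst p + b * fst q) * (a * fst p + b * fst q) + (a * snd p + b * snd q) * (a * snd p + b * snd q))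
  with (a * a * (fst p * fst p + snd p * snd p) + b * b * (fst q * fst q + snd q * snd q)
    + 2 * (a * b * (fst p * fst q + snd p * snd q))) by ring.
rewrite <- Hp, <- Hq, <- Ha, <- Hb. lra.
Qed.

Lemma gnorm_le_eucl_norm (m : R -> R) (p u : pt) :
  profile m -> m (rad p) <= rad p -> gnorm m p u <= eucl_norm u.
Proof.
intros Hm Hp. apply sqrt_le_1_alt. rewrite gdot_slope by apply Hm.
assert (0 <= slope m (rad p) <= 1).
{ unfold slope. destruct Req_EM_T as [E | E]; [lra |].
  pose proof (rad_ge_0 p). assert (0 < m (rad p)) by (apply Hm; lra).
  split; [left; apply Rdiv_lt_0_compat; lra |].
  apply Rmult_le_reg_r with (rad p); [lra |]. unfold Rdiv. rewrite Rmult_assoc, Rinv_l; lra. }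
pose proof (pow2_ge_0 (rad p * angular p u)).
assert (slope m (rad p) ^ 2 <= 1) by nra. nra.
Qed.

(* Follow the Euclidean segment from [p] to [q]. *)
Lemma gdist_le_rad_plus (m : R -> R) (p q : pt) (x y : R) :
  profile m -> (forall r, 0 <= r <= y -> m r <= r) -> rad p <= y -> rad q <= y ->
  gdist m p q = Finite x -> x <= rad p + rad q.
Proof.
intros Hm Hle Hp Hq Hx.
set (c := fun t => ((1 - t) * fst p + t * fst q, (1 - t) * snd p + t * snd q) : pt).
assert (HX : forall t, is_derive (fun s => fst (c s)) t (fst q - fst p)).
{ intros t. unfold c; simpl. auto_derive; [auto | ring]. }
assert (HY : forall t, is_derive (fun s => snd (c s)) t (snd q - snd p)).
{ intros t. unfold c; simpl. auto_derive; [auto | ring]. }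
assert (Hv : forall t, curve_vel c t = (fst q - fst p, snd q - snd p)).
{ intros t. unfold curve_vel. f_equal; apply is_derive_unique; [apply HX | apply HY]. }
assert (Hc : C1_curve c).
{ split; intros t; split.
  - now exists (fst q - fst p).
  - now exists (snd q - snd p).
  - apply (continuous_ext (fun _ => fst q - fst p)); [intros; now rewrite Hv | apply continuous_const].
  - apply (continuous_ext (fun _ => snd q - snd p)); [intros; now rewrite Hv | apply continuous_const]. }
assert (H0 : c 0 = p) by (unfold c; destruct p, q; simpl; f_equal; ring).
assert (H1 : c 1 = q) by (unfold c; destruct p, q; simpl; f_equal; ring).
rewrite <- H0, <- H1 in Hx.
apply Rle_trans with (1 := gdist_le_length m c x Hc Hx).
apply Rle_trans with (RInt (fun _ => rad p + rad q) 0 1);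
  [| rewrite (RInt_const (V := R_CompleteNormedModule)); unfold scal; simpl; unfold mult; simpl; lra].
apply RInt_le; [lra | | apply ex_RInt_const |].
{ apply (ex_RInt_continuous (V := R_CompleteNormedModule)). intros. now apply gnorm_continuous. }
intros t Ht. apply Rle_trans with (eucl_norm (curve_vel c t)).
- apply gnorm_le_eucl_norm; [exact Hm |]. apply Hle. split; [apply rad_ge_0 |].
  eapply Rle_trans; [apply rad_lin_comb |]. rewrite !Rabs_pos_eq by lra.
  pose proof (rad_ge_0 p). pose proof (rad_ge_0 q). nra.
- rewrite Hv. pose proof (rad_lin_comb (-1) 1 p q) as H.
  replace (Rabs (-1)) with 1 in H by (rewrite Rabs_left; lra). rewrite Rabs_R1, !Rmult_1_l in H.
  eapply Rle_trans; [| exact H]. right. unfold rad. f_equal. f_equal; ring.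
Qed.

(* [(r, theta)] in the polar coordinates whose axis is spanned by the unit vector [e], with orientation [s = 1] or [-1]. *)
Definition polar_point (e : pt) (s r th : R) : pt :=
  (r * (cos th * fst e - s * sin th * snd e), r * (cos th * snd e + s * sin th * fst e)).

Definition polar_vel (e : pt) (s r th dr dth : R) : pt :=
  (dr * (cos th * fst e - s * sin th * snd e) - r * dth * (sin th * fst e + s * cos th * snd e),
   dr * (cos th * snd e + s * sin th * fst e) - r * dth * (sin th * snd e - s * cos th * fst e)).

Lemma rad_polar_point (e : pt) (s r th : R) :
  eucl_dot e e = 1 -> s * s = 1 -> 0 <= r -> rad (polar_point e s r th) = r.
Proof.
intros He Hs Hr. transitivity (sqrt (r ^ 2)); [unfold rad, eucl_norm; f_equal | now apply sqrt_pow2].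
pose proof (sin2_cos2 th) as H. unfold Rsqr in H. unfold eucl_dot, polar_point in *. cbn [fst snd].
transitivity (r ^ 2 * ((s * s * (sin th * sin th) + cos th * cos th) * (fst e * fst e + snd e * snd e))); [ring |].
rewrite Hs, He, Rmult_1_l, H. ring.
Qed.

Lemma radial_polar (e : pt) (s r th dr dth : R) :
  eucl_dot e e = 1 -> s * s = 1 -> 0 < r ->
  radial (polar_point e s r th) (polar_vel e s r th dr dth) = dr.
Proof.
intros He Hs Hr. unfold radial. rewrite rad_polar_point by (auto; lra).
pose proof (sin2_cos2 th) as H. unfold Rsqr in H. unfold eucl_dot, polar_point, polar_vel in *. cbn [fst snd].
apply Rmult_eq_reg_r with r; [| lra]. unfold Rdiv at 1. rewrite (Rmult_assoc (_ + _)), Rinv_l, Rmult_1_r by lra.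
transitivity ((dr * r * ((s * s * (sin th * sin th) + cos th * cos th) * (fst e * fst e + snd e * snd e)))
  + r * r * dth * sin th * cos th * (s * s - 1) * (fst e * fst e + snd e * snd e)); [ring |].
rewrite He, Hs, Rmult_1_l, H. ring.
Qed.

Lemma angular_polar (e : pt) (s r th dr dth : R) :
  eucl_dot e e = 1 -> s * s = 1 -> 0 < r ->
  angular (polar_point e s r th) (polar_vel e s r th dr dth) = s * dth.
Proof.
intros He Hs Hr. unfold angular. rewrite rad_polar_point by (auto; lra).
pose proof (sin2_cos2 th) as H. unfold Rsqr in H. unfold eucl_dot, polar_point, polar_vel in *. cbn [fst snd].
apply Rmult_eq_reg_r with (r ^ 2); [| apply pow_nonzero; lra].
unfold Rdiv at 1. rewrite (Rmult_assoc (_ - _)), Rinv_l, Rmult_1_r by (apply pow_nonzero; lra).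
transitivity (s * r ^ 2 * dth * (((sin th * sin th) + cos th * cos th) * (fst e * fst e + snd e * snd e))); [ring |].
rewrite He, H. ring.
Qed.

Lemma polar_curve_C1 (e : pt) (s : R) (r th dr dth : R -> R) :
  (forall t, is_derive r t (dr t)) -> (forall t, is_derive th t (dth t)) ->
  (forall t, continuous dr t) -> (forall t, continuous dth t) ->
  C1_curve (fun t => polar_point e s (r t) (th t)) /\
  forall t, curve_vel (fun t => polar_point e s (r t) (th t)) t = polar_vel e s (r t) (th t) (dr t) (dth t).
Proof.
intros Hr Hth Hdr Hdth.
assert (Er : forall t, ex_derive r t) by (intros t; now exists (dr t)).
assert (Eth : forall t, ex_derive th t) by (intros t; now exists (dth t)).
assert (Dr : forall t, Derive (fun x => r x) t = dr t) by (intros t; now apply is_derive_unique).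
assert (Dth : forall t, Derive (fun x => th x) t = dth t) by (intros t; now apply is_derive_unique).
assert (HX : forall t, is_derive (fun t => fst (polar_point e s (r t) (th t))) t
  (fst (polar_vel e s (r t) (th t) (dr t) (dth t)))).
{ intros t. unfold polar_point, polar_vel; cbn [fst snd].
  auto_derive; [repeat split; auto | rewrite Dr, Dth; ring]. }
assert (HY : forall t, is_derive (fun t => snd (polar_point e s (r t) (th t))) t
  (snd (polar_vel e s (r t) (th t) (dr t) (dth t)))).
{ intros t. unfold polar_point, polar_vel; cbn [fst snd].
  auto_derive; [repeat split; auto | rewrite Dr, Dth; ring]. }
assert (Hv : forall t, curve_vel (fun t => polar_point e s (r t) (th t)) t = polar_vel e s (r t) (th t) (dr t) (dth t)).
{ intros t. unfold curve_vel. rewrite (surjective_pairing (polar_vel _ _ _ _ _ _)).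
  f_equal; apply is_derive_unique; [apply HX | apply HY]. }
assert (Hc : forall t, continuous (fun t => cos (th t)) t /\ continuous (fun t => sin (th t)) t /\ continuous r t).
{ intros t. assert (Hth' := is_derive_continuous _ _ _ (Hth t)). repeat split.
  - apply (continuous_comp th cos); [exact Hth' | apply continuous_cos].
  - apply (continuous_comp th sin); [exact Hth' | apply continuous_sin].
  - exact (is_derive_continuous _ _ _ (Hr t)). }
assert (HC : forall a b c d t,
  continuous (fun t => dr t * (cos (th t) * a + sin (th t) * b) + r t * dth t * (sin (th t) * c + cos (th t) * d)) t).
{ intros a b c d t. destruct (Hc t) as (H1 & H2 & H3).
  assert (HL : forall a b, continuous (fun t => cos (th t) * a + sin (th t) * b) t).
  { intros a' b'. apply (continuous_plus (V := R_NormedModule) (fun t => cos (th t) * a') (fun t => sin (th t) * b'));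
    apply (continuous_mult (K := R_AbsRing)); auto; apply continuous_const. }
  apply (continuous_plus (V := R_NormedModule) (fun t => dr t * (cos (th t) * a + sin (th t) * b))
    (fun t => r t * dth t * (sin (th t) * c + cos (th t) * d))).
  - apply (continuous_mult (K := R_AbsRing)); auto.
  - apply (continuous_mult (K := R_AbsRing) (fun t => r t * dth t)).
    + apply (continuous_mult (K := R_AbsRing)); auto.
    + apply (continuous_ext (fun t => cos (th t) * d + sin (th t) * c)); [intros; apply Rplus_comm | auto]. }
split; [split; intros t; split | exact Hv].
- eexists; apply HX.
- eexists; apply HY.
- refine (continuous_ext _ _ _ _ (HC (fst e) (- s * snd e) (- fst e) (- s * snd e) t)).
  intros u; cbv beta. rewrite Hv. unfold polar_vel; cbn [fst].
  match goal with |- ?x = ?y => change (@eq R x y) end. ring.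
- refine (continuous_ext _ _ _ _ (HC (snd e) (s * fst e) (- snd e) (s * fst e) t)).
  intros u; cbv beta. rewrite Hv. unfold polar_vel; cbn [snd].
  match goal with |- ?x = ?y => change (@eq R x y) end. ring.
Qed.

(** * Outward geodesics between two circles under a bound on m' *)

Section Comparison.

Variables (m : R -> R) (rho Y lam eta : R).
Hypothesis Hm : profile m.
Hypothesis HrY : 0 < rho < Y.
Hypothesis Hlam : 0 < lam.
Hypothesis Hder : forall r, rho <= r <= Y -> 0 < Derive m r <= lam.
(** Equivalent to (1 - eta) / lam > 2. The factor 1 / lam comes from the substitution s = m(r), and
    [eta] is the fraction of the turning angle that may be lost by stopping at [Y]; [Hratio] keeps
    the loss that small. *)
Hypothesis Heta : 2 * lam + eta < 1.
Hypothesis Hratio : 2 * m rho <= eta * m Y.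

Lemma profile_incr (r s : R) : rho <= r <= s -> s <= Y -> m r <= m s.
Proof.
intros Hr Hs.
assert (- m s - - m r <= 0 * (s - r)); [| lra].
apply (derive_le_increment (fun t => - m t) (fun t => - Derive m t) r s 0); try lra.
- intros t Ht. apply (is_derive_opp (V := R_NormedModule) m), profile_is_derive, Hm.
- intros t Ht. apply (continuous_opp (V := R_NormedModule) m), profile_continuous, Hm.
- intros t Ht. generalize (Hder t ltac:(lra)). lra.
Qed.

Lemma profile_pos (r : R) : 0 < r -> 0 < m r.
Proof. apply Hm. Qed.

Lemma eta_bounds : 0 < eta < 1.
Proof.
pose proof (profile_pos rho ltac:(lra)). pose proof (profile_pos Y ltac:(lra)). nra.
Qed.

(** By [Hratio], e / m(Y) is at most eta / 2 times e / m(rho), hence at most 1/2; [asin] at most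
    doubles the former and does not decrease the latter. *)
Lemma asin_ratio (e : R) : 0 <= e <= m rho -> asin (e / m Y) <= eta * asin (e / m rho).
Proof.
intros He. pose proof (profile_pos rho ltac:(lra)) as Ha. pose proof (profile_pos Y ltac:(lra)) as HS.
pose proof eta_bounds as Hb.
assert (H1 : 0 <= e / m rho <= 1).
{ split; [apply Rmult_le_pos; [lra | left; now apply Rinv_0_lt_compat] |].
  apply Rmult_le_reg_r with (m rho); [lra |]. unfold Rdiv. rewrite Rmult_assoc, Rinv_l; lra. }
assert (H2 : e / m Y <= eta / 2 * (e / m rho)).
{ apply Rmult_le_reg_r with (m Y * m rho * 2); [nra |].
  replace (e / m Y * (m Y * m rho * 2)) with (e * (2 * m rho)) by (field; lra).
  replace (eta / 2 * (e / m rho) * (m Y * m rho * 2)) with (e * (eta * m Y)) by (field; lra).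
  apply Rmult_le_compat_l; lra. }
assert (H3 : 0 <= e / m Y) by (apply Rmult_le_pos; [lra | left; now apply Rinv_0_lt_compat]).
pose proof (asin_le_double (e / m Y) ltac:(split; nra)).
pose proof (asin_ge (e / m rho) H1). nra.
Qed.

(** [asin_ratio] integrated over the Clairaut constant. *)
Lemma arc_primitive_ratio (c' c : R) :
  0 <= c' <= c -> c < m rho ->
  arc_primitive (m Y) c - arc_primitive (m Y) c' <= eta * (arc_primitive (m rho) c - arc_primitive (m rho) c').
Proof.
intros Hc Ha. pose proof (profile_incr rho Y ltac:(lra) ltac:(lra)) as HS.
set (f := fun e => arc_primitive (m Y) e - eta * arc_primitive (m rho) e).
assert (f c - f c' <= 0 * (c - c')); [| unfold f in *; lra].
assert (HD : forall t, c' <= t <= c -> is_derive f t (asin (t / m Y) - eta * asin (t / m rho))).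
{ intros t Ht.
  apply (is_derive_minus (V := R_NormedModule) (arc_primitive (m Y)) (fun e => eta * arc_primitive (m rho) e)).
  - apply arc_primitive_derive_e; lra.
  - apply (is_derive_scal (arc_primitive (m rho))), arc_primitive_derive_e; lra. }
apply (derive_le_increment f (fun t => asin (t / m Y) - eta * asin (t / m rho))); try lra.
- intros t Ht; apply HD; lra.
- intros t Ht; apply is_derive_continuous with (1 := HD t Ht).
- intros t Ht; pose proof (asin_ratio t ltac:(lra)); lra.
Qed.

Lemma arc_primitive_incr (c' c : R) :
  0 <= c' <= c -> c < m rho -> arc_primitive (m rho) c' <= arc_primitive (m rho) c.
Proof.
intros Hc Ha.
assert (- arc_primitive (m rho) c - - arc_primitive (m rho) c' <= 0 * (c - c')); [| lra].
assert (HD : forall t, c' <= t <= c -> is_derive (fun t => - arc_primitive (m rho) t) t (- asin (t / m rho))).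
{ intros t Ht. apply (is_derive_opp (V := R_NormedModule) (arc_primitive (m rho))), arc_primitive_derive_e; lra. }
apply (derive_le_increment (fun t => - arc_primitive (m rho) t) (fun t => - asin (t / m rho))); try lra.
- intros t Ht; apply HD; lra.
- intros t Ht; apply is_derive_continuous with (1 := HD t Ht).
- intros t Ht; pose proof (asin_ge_0 (t / m rho)) as H. pose proof (div_lt_1 t (m rho) ltac:(lra)). lra.
Qed.

(* The derivative of the angle with respect to [r] along a geodesic with Clairaut constant [e]. *)
Definition turn_rate (e r : R) : R := e / (m r * sqrt (m r ^ 2 - e ^ 2)).
Definition turn (e : R) : R := RInt (turn_rate e) rho Y.
(** The radial component of the unit velocity of that geodesic. Since 1 / radial_part = e turn_rate
    + radial_part, the geodesic has length [e * turn e + radial_length e]. Formally, [- turn e] is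
    the derivative of [radial_length e]. *)
Definition radial_part (e r : R) : R := sqrt (1 - (e / m r) ^ 2).
Definition radial_length (e : R) : R := RInt (radial_part e) rho Y.

Lemma radial_part_continuous (e r : R) : 0 < r -> continuous (radial_part e) r.
Proof.
intros Hr. apply continuous_sqrt_comp.
pose proof (profile_pos r Hr).
apply (continuous_comp m (fun s => 1 - (e / s) ^ 2)); [now apply profile_continuous |].
apply (ex_derive_continuous (V := R_NormedModule)). auto_derive. lra.
Qed.

Lemma turn_rate_continuous (e r : R) : 0 <= e < m r -> continuous (turn_rate e) r.
Proof.
intros He.
apply (continuous_comp m (fun s => e / (s * sqrt (s ^ 2 - e ^ 2)))); [now apply profile_continuous |].
apply (ex_derive_continuous (V := R_NormedModule)).
assert (Hp : 0 < m r ^ 2 - e ^ 2) by nra. pose proof (sqrt_lt_R0 _ Hp).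
auto_derive. simpl in Hp, H. split; [exact Hp | split; [| exact I]].
apply Rmult_integral_contrapositive_currified; [lra |].
apply Rgt_not_eq. exact H.
Qed.

(** [- asin (e / m r)] has derivative m' turn_rate <= lam turn_rate in [r], and [asin_ratio] bounds
    its value at [Y]. With [Heta] this gives turn e > 2 asin (e / m(rho)) for e > 0. *)
Lemma asin_le_turn (e : R) : 0 <= e < m rho -> (1 - eta) * asin (e / m rho) <= lam * turn e.
Proof.
intros He.
assert (H : Rabs (asin (e / m Y) - asin (e / m rho)) <= RInt (fun r => lam * turn_rate e r) rho Y).
{ apply (increment_le_RInt (fun r => asin (e / m r))); [lra | |].
  - intros t Ht. apply (continuous_scal_r (V := R_NormedModule) lam (turn_rate e)).
    apply turn_rate_continuous. pose proof (profile_incr rho t ltac:(lra) ltac:(lra)). lra.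
  - intros t Ht. pose proof (profile_incr rho t ltac:(lra) ltac:(lra)) as Hmt.
    pose proof (div_lt_1 e (m t) ltac:(lra)) as Hd.
    assert (Hp : 0 < m t ^ 2 - e ^ 2) by nra. pose proof (sqrt_lt_R0 _ Hp) as HS.
    exists (- (Derive m t * turn_rate e t)). split.
    + evar_last.
      * apply (is_derive_comp asin (fun r => e / m r)); [apply is_derive_asin; lra |].
        apply (is_derive_comp (fun s => e / s) m t (- e / m t ^ 2)); [| now apply profile_is_derive].
        auto_derive; [lra | field; lra].
      * rewrite sqrt_one_minus_div by lra. unfold turn_rate, scal; simpl. unfold mult; simpl.
        simpl in HS. rewrite !Rmult_1_r in *. field. lra.
    + rewrite Rabs_Ropp, Rabs_mult. specialize (Hder t Ht).
      assert (0 <= turn_rate e t).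
      { apply Rmult_le_pos; [lra |]. left; apply Rinv_0_lt_compat, Rmult_lt_0_compat; lra. }
      rewrite !Rabs_pos_eq; try lra. apply Rmult_le_compat_r; lra. }
rewrite (RInt_scal (V := R_CompleteNormedModule)) in H.
- apply Rabs_le_between in H. pose proof (asin_ratio e ltac:(lra)).
  unfold turn, scal in *; simpl in H; unfold mult in H; simpl in H. lra.
- apply (ex_RInt_continuous (V := R_CompleteNormedModule)). intros t Ht.
  rewrite Rmin_left, Rmax_right in Ht by lra.
  apply turn_rate_continuous. pose proof (profile_incr rho t ltac:(lra) ltac:(lra)). lra.
Qed.

(** The inequality turn e >= 2 asin (e / m(rho)) integrated over [e] from [c'] to [c].
    Differentiation under the integral is avoided: [arc_primitive (m r) e] has derivative m'
    radial_part in [r], so the increments are compared along [r] as in [asin_le_turn]. *)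
Lemma arc_primitive_le_radial_length (c' c : R) :
  0 <= c' <= c -> c < m rho ->
  2 * (arc_primitive (m rho) c - arc_primitive (m rho) c') <= radial_length c' - radial_length c.
Proof.
intros Hc Ha.
assert (Hex : forall e, ex_RInt (radial_part e) rho Y).
{ intros e. apply (ex_RInt_continuous (V := R_CompleteNormedModule)). intros t Ht.
  rewrite Rmin_left, Rmax_right in Ht by lra. apply radial_part_continuous; lra. }
set (g := fun r => radial_part c' r - radial_part c r).
set (f := fun r => arc_primitive (m r) c' - arc_primitive (m r) c).
assert (H : Rabs (f Y - f rho) <= RInt (fun r => lam * g r) rho Y).
{ apply (increment_le_RInt f); [lra | |].
  - intros t Ht. apply (continuous_scal_r (V := R_NormedModule) lam g).
    apply (continuous_minus (V := R_NormedModule) (radial_part c') (radial_part c)); apply radial_part_continuous; lra.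
  - intros t Ht. pose proof (profile_incr rho t ltac:(lra) ltac:(lra)) as Hmt.
    exists (Derive m t * radial_part c' t - Derive m t * radial_part c t). split.
    + apply (is_derive_minus (V := R_NormedModule) (fun r => arc_primitive (m r) c') (fun r => arc_primitive (m r) c));
      [apply (is_derive_comp (fun s => arc_primitive s c') m) | apply (is_derive_comp (fun s => arc_primitive s c) m)];
      try (now apply profile_is_derive); apply arc_primitive_derive_s; lra.
    + rewrite <- Rmult_minus_distr_l, Rabs_mult. specialize (Hder t Ht).
      assert (0 <= g t).
      { unfold g, radial_part. apply Rge_le, Rge_minus, Rle_ge, sqrt_le_1_alt.
        apply Rplus_le_compat_l, Ropp_le_contravar, pow_incr.
        split; [apply div_lt_1; lra |]. apply Rmult_le_compat_r; [left; apply Rinv_0_lt_compat |]; lra. }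
      unfold g in *. rewrite !Rabs_pos_eq; try lra. apply Rmult_le_compat_r; lra. }
rewrite (RInt_scal (V := R_CompleteNormedModule)) in H
  by (apply (ex_RInt_minus (V := R_NormedModule) (radial_part c') (radial_part c)); auto).
unfold g in H.
rewrite (RInt_minus (V := R_CompleteNormedModule) (radial_part c') (radial_part c)) in H by auto.
apply Rabs_le_between in H. unfold f in H.
unfold scal, minus, plus, opp in H; simpl in H; unfold mult in H; simpl in H.
fold (radial_length c') (radial_length c) in H.
pose proof (arc_primitive_ratio c' c Hc Ha). pose proof (arc_primitive_incr c' c Hc Ha).
pose proof eta_bounds.
apply Rmult_le_reg_l with lam; [lra |]. nra.
Qed.

(** The derivative in [e] is m / (m^2 - e^2)^(3/2) with m(rho) <= m <= m(Y). The bound [b < m rho]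
    keeps it away from the singularity e = m(rho) at r = rho. *)
Lemma turn_rate_lipschitz (b e e' r : R) :
  0 <= e <= e' -> e' <= b -> b < m rho -> rho <= r <= Y ->
  Rabs (turn_rate e' r - turn_rate e r) <= m Y / sqrt (m rho ^ 2 - b ^ 2) ^ 3 * (e' - e).
Proof.
intros He Hb Ha Hr.
pose proof (profile_incr rho r ltac:(lra) ltac:(lra)) as H1.
pose proof (profile_incr r Y ltac:(lra) ltac:(lra)) as H2.
assert (Hw : 0 < m rho ^ 2 - b ^ 2) by nra. pose proof (sqrt_lt_R0 _ Hw) as Hw'.
set (w := sqrt (m rho ^ 2 - b ^ 2)) in *.
set (s := m r) in *.
set (df := fun t => s / sqrt (s ^ 2 - t ^ 2) ^ 3).
assert (HD : forall t, e <= t <= e' ->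
  is_derive (fun t => turn_rate t r) t (df t) /\ 0 <= df t <= m Y / w ^ 3).
{ intros t Ht. unfold turn_rate. fold s.
  assert (Hp : 0 < s ^ 2 - t ^ 2) by nra. pose proof (sqrt_lt_R0 _ Hp) as Hp'.
  assert (w <= sqrt (s ^ 2 - t ^ 2)) by (apply sqrt_le_1_alt; nra).
  unfold df. pose proof (sqrt_sqrt (s ^ 2 - t ^ 2) ltac:(lra)) as HH.
  split.
  - evar_last.
    + apply (is_derive_div (fun t => t) (fun t => s * sqrt (s ^ 2 - t ^ 2))).
      * apply (is_derive_id (K := R_AbsRing)).
      * apply (is_derive_scal (fun t => sqrt (s ^ 2 - t ^ 2))).
        apply (is_derive_sqrt (fun t => s ^ 2 - t ^ 2) t (- (2 * t))); [| exact Hp].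
        auto_derive; [auto | ring].
      * apply Rmult_integral_contrapositive_currified; lra.
    + unfold one; simpl. simpl in HH, Hp'. rewrite !Rmult_1_r in *.
      set (u := sqrt (s * s - t * t)) in *.
      apply Rmult_eq_reg_r with (u * u * u * s); [| repeat apply Rmult_integral_contrapositive_currified; lra].
      transitivity (u * u + t * t); [field; lra |].
      transitivity (s * s); [lra | field; lra].
  - set (u := sqrt (s ^ 2 - t ^ 2)) in *.
    assert (0 < w ^ 3) by (apply pow_lt; lra). assert (w ^ 3 <= u ^ 3) by (apply pow_incr; lra).
    split.
    + apply Rmult_le_pos; [lra | left; apply Rinv_0_lt_compat; lra].
    + apply Rmult_le_compat; try lra; [left; apply Rinv_0_lt_compat; lra |].
      apply Rinv_le_contravar; lra. }
apply Rabs_le_between; split.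
- assert (- turn_rate e' r - - turn_rate e r <= 0 * (e' - e)).
  { apply (derive_le_increment (fun t => - turn_rate t r) (fun t => - df t)); try lra.
    - intros t Ht. apply (is_derive_opp (V := R_NormedModule) (fun t => turn_rate t r)), HD; lra.
    - intros t Ht. apply (continuous_opp (V := R_NormedModule) (fun t => turn_rate t r)).
      apply is_derive_continuous with (1 := proj1 (HD t Ht)).
    - intros t Ht. generalize (proj2 (HD t ltac:(lra))). lra. }
  assert (0 <= m Y / w ^ 3 * (e' - e)); [| lra].
  apply Rmult_le_pos; [| lra]. generalize (proj2 (HD e ltac:(lra))). lra.
- apply (derive_le_increment (fun t => turn_rate t r) df); try lra.
  + intros t Ht. apply HD; lra.
  + intros t Ht. apply is_derive_continuous with (1 := proj1 (HD t Ht)).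
  + intros t Ht. apply HD; lra.
Qed.

Lemma ex_RInt_turn_rate (e : R) : 0 <= e < m rho -> ex_RInt (turn_rate e) rho Y.
Proof.
intros He. apply (ex_RInt_continuous (V := R_CompleteNormedModule)). intros t Ht.
rewrite Rmin_left, Rmax_right in Ht by lra.
apply turn_rate_continuous. pose proof (profile_incr rho t ltac:(lra) ltac:(lra)). lra.
Qed.

Lemma turn_lipschitz (b e e' : R) :
  0 <= e <= b -> 0 <= e' <= b -> b < m rho ->
  Rabs (turn e - turn e') <= (Y - rho) * (m Y / sqrt (m rho ^ 2 - b ^ 2) ^ 3) * Rabs (e - e').
Proof.
assert (H : forall e e', 0 <= e <= e' -> e' <= b -> b < m rho ->
  Rabs (turn e' - turn e) <= (Y - rho) * (m Y / sqrt (m rho ^ 2 - b ^ 2) ^ 3) * (e' - e)).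
{ clear e e'. intros e e' He Hb Ha.
  pose proof (ex_RInt_turn_rate e ltac:(lra)). pose proof (ex_RInt_turn_rate e' ltac:(lra)).
  unfold turn.
  rewrite <- (RInt_minus (V := R_CompleteNormedModule) (turn_rate e') (turn_rate e)) by auto.
  rewrite Rmult_assoc.
  apply abs_RInt_le_const; [lra | now apply (ex_RInt_minus (V := R_NormedModule)) |].
  intros t Ht. apply turn_rate_lipschitz; lra. }
intros He He' Hb. destruct (Rle_lt_dec e e') as [Hle | Hlt].
- rewrite Rabs_minus_sym, (Rabs_minus_sym e), (Rabs_pos_eq (e' - e)) by lra. apply H; lra.
- rewrite (Rabs_pos_eq (e - e')) by lra. apply H; lra.
Qed.

Lemma turn_onto (psi : R) : 0 <= psi <= PI -> exists c, 0 <= c < m rho /\ turn c = psi.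
Proof.
intros Hpsi. pose proof (profile_pos rho ltac:(lra)) as Ha. pose proof (profile_pos Y ltac:(lra)) as HS.
pose proof eta_bounds as Heb. pose proof PI_RGT_0 as HPI.
(* Chosen so that (1 - eta) x = lam PI: then [asin_le_turn] at b = m(rho) sin x gives
   [turn b >= PI]. [Heta] makes x < PI / 2, hence b < m(rho). *)
set (x := PI * lam / (1 - eta)).
assert (Hx : 0 < x < PI / 2).
{ unfold x. split; [apply Rdiv_lt_0_compat; nra |].
  apply Rmult_lt_reg_r with (1 - eta); [lra |]. unfold Rdiv. rewrite Rmult_assoc, Rinv_l; nra. }
set (b := m rho * sin x).
assert (Hs : 0 < sin x < 1).
{ split; [apply sin_gt_0; lra |]. rewrite <- sin_PI2. apply sin_increasing_1; lra. }
assert (Hb : 0 < b < m rho) by (unfold b; nra).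
assert (Hw : 0 < m rho ^ 2 - b ^ 2) by nra. pose proof (sqrt_lt_R0 _ Hw) as Hw'.
set (C := (Y - rho) * (m Y / sqrt (m rho ^ 2 - b ^ 2) ^ 3)).
assert (HC : 0 < C).
{ unfold C. apply Rmult_lt_0_compat; [lra |]. apply Rdiv_lt_0_compat; [lra | now apply pow_lt]. }
(* Division by the Lipschitz constant on [[0, b]] meets the hypothesis of [last_visit]; only the
   value attained is kept. *)
destruct (last_visit (fun e => turn e / C) b (psi / C)) as (c & Hc1 & Hc2 & _).
- lra.
- assert (turn 0 = 0) as ->.
  { unfold turn. rewrite (RInt_ext (V := R_CompleteNormedModule) _ (fun _ => 0)).
    - rewrite (RInt_const (V := R_CompleteNormedModule)). unfold scal; simpl; unfold mult; simpl; ring.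
    - intros; unfold turn_rate, Rdiv; apply Rmult_0_l. }
  apply Rmult_le_compat_r; [left; now apply Rinv_0_lt_compat | lra].
- apply Rmult_le_compat_r; [left; now apply Rinv_0_lt_compat |].
  apply Rle_trans with PI; [lra |].
  pose proof (asin_le_turn b ltac:(lra)) as H.
  replace (b / m rho) with (sin x) in H by (unfold b; field; lra).
  rewrite asin_sin in H by lra.
  apply Rmult_le_reg_l with lam; [lra |].
  replace ((1 - eta) * x) with (lam * PI) in H by (unfold x; field; lra). exact H.
- intros s t Hs' Ht.
  replace (turn s / C - turn t / C) with ((turn s - turn t) / C) by (field; lra).
  unfold Rdiv. rewrite Rabs_mult, (Rabs_pos_eq (/ C)) by (left; now apply Rinv_0_lt_compat).
  apply Rmult_le_reg_r with C; [lra |].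
  rewrite Rmult_assoc, Rinv_l, Rmult_1_r by lra.
  rewrite Rmult_comm. apply turn_lipschitz; lra.
- exists c. split; [lra |]. apply Rmult_eq_reg_r with (/ C); [exact Hc2 |].
  apply Rinv_neq_0_compat; lra.
Qed.

(* The left-hand side is the length of the outward geodesic with Clairaut constant [c]; on the right, [2 m(rho) sin v] is a
   chord of the flat disc of radius [m rho], followed by an outward path turning by the remaining angle. *)
Lemma detour_longer (c v : R) :
  0 <= c < m rho -> turn c <= PI -> 0 < v <= PI / 2 ->
  exists c', 0 <= c' <= c /\
    c * turn c + radial_length c < 2 * m rho * sin v + c' * Rmax (turn c - 2 * v) 0 + radial_length c'.
Proof.
intros Hc Ht Hv. pose proof (profile_pos rho ltac:(lra)) as Ha. pose proof eta_bounds as Heb.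
set (al := asin (c / m rho)). set (be := turn c / 2).
pose proof (div_lt_1 c (m rho) ltac:(lra)) as Hd.
assert (Hal : 0 <= al < PI / 2).
{ split; [apply asin_ge_0; lra | apply asin_bound_lt; lra]. }
assert (Hsa : c = m rho * sin al) by (unfold al; rewrite sin_asin by lra; field; lra).
(* [asin_le_turn] and 2 lam < 1 - eta make half of the turning angle exceed [al], unless c = 0. *)
assert (Hab : al < be \/ al = 0 /\ c = 0 /\ 0 <= be).
{ pose proof (asin_le_turn c Hc) as H. fold al in H.
  destruct (Rle_lt_or_eq_dec 0 al ltac:(lra)) as [H0 | H0].
  - left. unfold be. apply Rmult_lt_reg_l with (2 * lam); [lra |].
    replace (2 * lam * (turn c / 2)) with (lam * turn c) by field. nra.
  - right. rewrite <- H0, sin_0 in Hsa. split; [auto | split; [lra |]]. unfold be.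
    rewrite <- H0, Rmult_0_r in H. nra. }
assert (Hbe : 0 <= be <= PI / 2) by (split; [destruct Hab; lra | unfold be; lra]).
(* With R = max (be - v, 0), the quantity sin t (R - t) - cos t to be maximized has derivative cos t
   (R - t). So t = R is best, capped at [al] because of c' <= c. *)
set (al' := Rmin al (Rmax (be - v) 0)).
assert (Hal' : 0 <= al' <= al /\ al' <= Rmax (be - v) 0).
{ unfold al'. split; [split; [apply Rmin_glb; [lra | apply Rmax_r] | apply Rmin_l] | apply Rmin_r]. }
assert (Hprim : forall x, 0 <= x < PI / 2 -> arc_primitive (m rho) (m rho * sin x) = m rho * (cos x + x * sin x)).
{ intros x Hx. unfold arc_primitive.
  replace (m rho * sin x / m rho) with (sin x) by (field; lra). rewrite asin_sin by lra.
  replace (m rho ^ 2 - (m rho * sin x) ^ 2) with ((m rho * cos x) ^ 2).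
  - rewrite sqrt_pow2; [ring |]. apply Rmult_le_pos; [lra | apply cos_ge_0; lra].
  - pose proof (sin2_cos2 x) as H. unfold Rsqr in H.
    transitivity (m rho ^ 2 * (cos x * cos x)); [ring |].
    replace (cos x * cos x) with (1 - sin x * sin x) by lra. ring. }
assert (Hsin : 0 <= sin al' <= sin al).
{ split; [apply sin_ge_0; lra |].
  destruct (Rle_lt_or_eq_dec al' al ltac:(lra)) as [H | ->]; [left; apply sin_increasing_1 |]; lra. }
exists (m rho * sin al').
assert (Hc' : 0 <= m rho * sin al' <= c) by (rewrite Hsa; split; nra).
split; [exact Hc' |].
pose proof (arc_primitive_le_radial_length (m rho * sin al') c Hc' ltac:(lra)) as HI.
rewrite Hsa in HI at 1. rewrite !Hprim in HI by lra.
replace (turn c) with (2 * be) by (unfold be; field).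
replace (Rmax (2 * be - 2 * v) 0) with (2 * Rmax (be - v) 0)
  by (unfold Rmax; repeat destruct Rle_dec; lra).
(* What remains after inserting [HI] and dividing by 2 m(rho). *)
enough (Hkey : (be - al) * sin al < sin v + sin al' * (Rmax (be - v) 0 - al') + cos al - cos al').
{ assert (Hk2 := Rmult_lt_compat_l (2 * m rho) _ _ ltac:(lra) Hkey). rewrite Hsa at 1. nra. }
assert (Hcosv : 0 <= cos v) by (apply cos_ge_0; lra).
assert (Hsv : 0 < sin v) by (apply sin_gt_0; lra).
destruct (Rle_lt_dec be v) as [Hbv | Hbv].
- rewrite Rmax_right in * by lra. assert (al' = 0) as -> by lra.
  rewrite sin_0, cos_0.
  destruct Hab as [Hab | (Hab & _ & _)].
  (* (be - al) sin al < cos al - cos be by the tangent, and 1 - cos be <= sin be <= sin v. *)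
  + pose proof (cos_tangent_lt al be ltac:(lra) ltac:(lra)).
    assert (sin be <= sin v).
    { destruct (Rle_lt_or_eq_dec be v Hbv) as [H1 | ->]; [left; apply sin_increasing_1 |]; lra. }
    assert (0 <= sin be) by (apply sin_ge_0; lra). assert (0 <= cos be) by (apply cos_ge_0; lra).
    pose proof (sin2_cos2 be) as H4. unfold Rsqr in H4. nra.
  + rewrite Hab, sin_0, cos_0. lra.
- rewrite Rmax_left in * by lra.
  destruct (Rle_lt_dec al (be - v)) as [Hs | Hs].
  (* The claim reduces to v sin al < sin v, and sin al <= cos v because al + v <= be <= PI / 2. *)
  + assert (al' = al) as -> by (unfold al'; apply Rmin_left; rewrite Rmax_left by lra; lra).
    pose proof (mul_cos_lt_sin v Hv).
    assert (sin al <= cos v).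
    { rewrite <- sin_shift.
      destruct (Rle_lt_or_eq_dec al (PI / 2 - v) ltac:(lra)) as [H1 | ->]; [left; apply sin_increasing_1 |]; lra. }
    nra.
  + assert (al' = be - v) as -> by (unfold al'; rewrite Rmax_left by lra; apply Rmin_right; lra).
    destruct Hab as [Hab | (Hab & _ & _)]; [| lra].
    pose proof (cos_tangent_lt al be ltac:(lra) ltac:(lra)).
    rewrite Rminus_diag, Rmult_0_r, Rplus_0_r.
    enough (cos (be - v) <= sin v + cos be) by lra.
    (* [cos (be - v) - cos be = 2 sin (be - v / 2) sin (v / 2)] and [sin v = 2 cos (v / 2) sin (v / 2)] *)
    assert (sin (be - v / 2) <= cos (v / 2)).
    { rewrite <- sin_shift.
      destruct (Rle_lt_or_eq_dec (be - v / 2) (PI / 2 - v / 2) ltac:(lra)) as [H1 | ->]; [left; apply sin_increasing_1 |]; lra. }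
    assert (0 <= sin (v / 2)) by (apply sin_ge_0; lra).
    pose proof (form2 (be - v) be) as HF.
    replace ((be - v - be) / 2) with (- (v / 2)) in HF by field.
    replace ((be - v + be) / 2) with (be - v / 2) in HF by field.
    rewrite sin_neg in HF.
    pose proof (sin_2a (v / 2)) as HG. replace (2 * (v / 2)) with v in HG by field. nra.
Qed.

(* The geodesic with Clairaut constant [c], parametrized proportionally to the distance to the origin. *)
Lemma gdist_le_outward_length (c s x : R) (e : pt) :
  0 <= c < m rho -> eucl_dot e e = 1 -> s * s = 1 ->
  gdist m (polar_point e s rho 0) (polar_point e s Y (turn c)) = Finite x ->
  x <= c * turn c + radial_length c.
Proof.
intros Hc He Hs Hx.
(* A [C1_curve] is defined on all of R, while [turn_rate c] is controlled on [[rho, Y]] only. *)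
set (k := fun r => turn_rate c (clamp rho Y r)).
assert (Hk : forall r, continuous k r).
{ intros r. apply continuous_comp_clamp; [lra |]. intros t Ht. apply turn_rate_continuous.
  pose proof (profile_incr rho t ltac:(lra) ltac:(lra)). lra. }
set (r := fun t => (Y - rho) * t + rho).
set (th := fun t => RInt k rho (r t)).
assert (Hr : forall t, is_derive r t (Y - rho)) by (intros t; unfold r; auto_derive; [auto | ring]).
assert (Hth : forall t, is_derive th t ((Y - rho) * k (r t))).
{ intros t. apply (is_derive_comp (fun x => RInt k rho x) r t (k (r t)) (Y - rho)); [| apply Hr].
  apply (is_derive_RInt_continuous k (Rmin rho (r t) - 1) (Rmax rho (r t) + 1)); auto;
  unfold Rmin, Rmax; destruct Rle_dec; lra. }
destruct (polar_curve_C1 e s r th (fun _ => Y - rho) (fun t => (Y - rho) * k (r t)) Hr Hth) as [HC1 Hvel].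
{ intros; apply continuous_const. }
{ intros t. apply (continuous_mult (K := R_AbsRing) (fun _ => Y - rho) (fun t => k (r t))); [apply continuous_const |].
  apply (continuous_comp r k); [exact (is_derive_continuous _ _ _ (Hr t)) | apply Hk]. }
set (g := fun t => polar_point e s (r t) (th t)) in *.
assert (H0 : g 0 = polar_point e s rho 0).
{ unfold g, th. replace (r 0) with rho by (unfold r; ring).
  now rewrite (RInt_point (V := R_CompleteNormedModule)). }
assert (Hkr : forall u, rho <= u <= Y -> k u = turn_rate c u).
{ intros u Hu. unfold k. now rewrite clamp_id. }
assert (H1 : g 1 = polar_point e s Y (turn c)).
{ unfold g, th. replace (r 1) with Y by (unfold r; ring). f_equal.
  apply (RInt_ext (V := R_CompleteNormedModule)). intros u Hu. apply Hkr.
  rewrite Rmin_left, Rmax_right in Hu by lra. lra. }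
rewrite <- H0, <- H1 in Hx.
apply Rle_trans with (1 := gdist_le_length m g x HC1 Hx). right.
assert (Hex1 := ex_RInt_turn_rate c Hc).
assert (Hex2 : ex_RInt (radial_part c) rho Y).
{ apply (ex_RInt_continuous (V := R_CompleteNormedModule)). intros t Ht.
  rewrite Rmin_left, Rmax_right in Ht by lra. apply radial_part_continuous; lra. }
set (f := fun u => c * turn_rate c u + radial_part c u).
assert (Hex3 : ex_RInt (fun u => c * turn_rate c u) rho Y)
  by now apply (ex_RInt_scal (V := R_NormedModule) (turn_rate c)).
assert (Hf : RInt f rho Y = c * turn c + radial_length c).
{ unfold f.
  rewrite (RInt_plus (V := R_CompleteNormedModule) (fun u => c * turn_rate c u) (radial_part c)) by auto.
  now rewrite (RInt_scal (V := R_CompleteNormedModule) (turn_rate c)) by auto. }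
rewrite <- Hf. unfold curve_length.
replace rho with ((Y - rho) * 0 + rho) at 1 by ring. replace Y with ((Y - rho) * 1 + rho) at 2 by ring.
rewrite <- (RInt_comp_lin (V := R_CompleteNormedModule)).
2:{ replace ((Y - rho) * 0 + rho) with rho by ring. replace ((Y - rho) * 1 + rho) with Y by ring.
    now apply (ex_RInt_plus (V := R_NormedModule) (fun u => c * turn_rate c u) (radial_part c)). }
apply (RInt_ext (V := R_CompleteNormedModule)). intros t Ht.
rewrite Rmin_left, Rmax_right in Ht by lra.
assert (Hrt : rho <= r t <= Y) by (unfold r; nra).
rewrite Hvel. fold (r t).
assert (Hrad : rad (g t) = r t) by (apply rad_polar_point; auto; lra).
rewrite gnorm_polar by (rewrite Hrad; lra). rewrite Hrad. unfold g.
rewrite radial_polar, angular_polar by (auto; lra). rewrite Hkr by exact Hrt.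
unfold scal; simpl; unfold mult; simpl.
change ((Y - rho) * t + rho) with (r t). unfold f.
pose proof (profile_incr rho (r t) ltac:(lra) ltac:(lra)) as HM.
set (M := m (r t)) in *.
unfold turn_rate, radial_part. fold M. rewrite sqrt_one_minus_div by lra.
assert (Hp : 0 < M ^ 2 - c ^ 2) by nra. pose proof (sqrt_lt_R0 _ Hp) as Hu.
pose proof (sqrt_sqrt (M ^ 2 - c ^ 2) ltac:(lra)) as Huu.
set (u := sqrt (M ^ 2 - c ^ 2)) in *.
(* M / u is the arc length per unit of [r], the reciprocal of the radial part, which also equals c
   turn_rate + radial_part. *)
transitivity ((Y - rho) * (M / u)).
- rewrite <- (sqrt_pow2 ((Y - rho) * (M / u))).
  + f_equal.
    transitivity ((Y - rho) ^ 2 * (1 + (s * s) * (c / u) ^ 2)); [field; lra |].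
    rewrite Hs. transitivity ((Y - rho) ^ 2 * ((u * u + c ^ 2) / (u * u))); [field; lra |].
    rewrite Huu at 1. field; lra.
  + apply Rmult_le_pos; [lra |]. left. apply Rdiv_lt_0_compat; lra.
- f_equal. transitivity ((c ^ 2 + u * u) / (M * u)); [rewrite Huu; field; lra | field; lra].
Qed.

End Comparison.

(** * Rays from a circle of radius rho *)

Definition direction (p : pt) : pt := (fst p / rad p, snd p / rad p).

Lemma direction_unit (p : pt) : rad p <> 0 -> eucl_dot (direction p) (direction p) = 1.
Proof.
intros Hp. pose proof (rad_sqr p) as H. unfold eucl_dot, direction; cbn [fst snd].
transitivity ((fst p * fst p + snd p * snd p) / (rad p * rad p)); [field; auto |].
rewrite <- H. field; auto.
Qed.

Lemma cosine_direction (w p : pt) : cosine w p = eucl_dot (direction p) w.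
Proof. unfold cosine, eucl_dot, direction; cbn [fst snd]. unfold Rdiv. ring. Qed.

Lemma acos_le (x y : R) : -1 <= x -> x <= y -> y <= 1 -> acos y <= acos x.
Proof.
intros H1 H2 H3. apply Rnot_lt_le; intros Hlt.
pose proof (acos_bound x). pose proof (acos_bound y).
pose proof (cos_decreasing_1 (acos x) (acos y)) as Hc.
rewrite !cos_acos in Hc by lra. lra.
Qed.

(** The triangle inequality for angles. If the sum is below PI, its cosine is the product of the two
    cosines minus |s t|, where [s] and [t] are the cross products, and the dot product of [u] and
    [w] is the same with s t instead. *)
Lemma acos_dot_triangle (u v w : pt) :
  eucl_dot u u = 1 -> eucl_dot v v = 1 -> eucl_dot w w = 1 ->
  acos (eucl_dot u w) <= acos (eucl_dot u v) + acos (eucl_dot v w).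
Proof.
intros Hu Hv Hw.
assert (Hb : forall a b, eucl_dot a a = 1 -> eucl_dot b b = 1 ->
  eucl_dot a b ^ 2 + (fst a * snd b - snd a * fst b) ^ 2 = 1).
{ intros a b Ha Hb. unfold eucl_dot in *.
  transitivity ((fst a * fst a + snd a * snd a) * (fst b * fst b + snd b * snd b)); [ring |].
  rewrite Ha, Hb; ring. }
assert (H1 : forall a b, eucl_dot a a = 1 -> eucl_dot b b = 1 -> -1 <= eucl_dot a b <= 1).
{ intros a b Ha Hb'. pose proof (Hb a b Ha Hb'). pose proof (pow2_ge_0 (fst a * snd b - snd a * fst b)). nra. }
pose proof (H1 u v Hu Hv) as Huv. pose proof (H1 v w Hv Hw) as Hvw. pose proof (H1 u w Hu Hw) as Huw.
destruct (Rle_lt_dec PI (acos (eucl_dot u v) + acos (eucl_dot v w))) as [Hle | Hlt].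
{ pose proof (acos_bound (eucl_dot u w)). lra. }
pose proof (acos_bound (eucl_dot u v)). pose proof (acos_bound (eucl_dot v w)).
rewrite <- (acos_cos (acos (eucl_dot u v) + acos (eucl_dot v w))) by lra.
pose proof (COS_bound (acos (eucl_dot u v) + acos (eucl_dot v w))).
apply acos_le; try lra.
rewrite cos_plus, !cos_acos, !sin_acos by auto.
pose proof (Hb u v Hu Hv) as Euv. pose proof (Hb v w Hv Hw) as Evw.
set (s := fst u * snd v - snd u * fst v) in *. set (t := fst v * snd w - snd v * fst w) in *.
assert (E : eucl_dot u w = eucl_dot u v * eucl_dot v w - s * t).
{ unfold s, t, eucl_dot in *.
  transitivity ((fst u * fst w + snd u * snd w) * (fst v * fst v + snd v * snd v)); [rewrite Hv | ]; ring. }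
unfold Rsqr.
replace (1 - eucl_dot u v * eucl_dot u v) with (Rsqr s) by (unfold Rsqr; nra).
replace (1 - eucl_dot v w * eucl_dot v w) with (Rsqr t) by (unfold Rsqr; nra).
rewrite !sqrt_Rsqr_abs, <- Rabs_mult, E. pose proof (Rle_abs (s * t)). lra.
Qed.

(** Removes the damping in [clairaut]: some [k < 1] costs at most [eps] both at the angle [acos x]
    and at angle 0. *)
Lemma acos_scal_near (x eps : R) :
  -1 <= x <= 1 -> 0 < eps <= PI ->
  exists k, 0 <= k < 1 /\ acos x - eps <= acos (k * x) /\ acos k <= eps.
Proof.
intros Hx Heps.
assert (Hce : cos eps < 1) by (rewrite <- cos_0; apply cos_decreasing_1; lra).
pose proof (acos_bound x) as Hb.
assert (Hk : exists k0, k0 < 1 /\ forall k, 0 <= k < 1 -> k0 <= k -> acos x - eps <= acos (k * x)).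
{ destruct (Rle_lt_dec (acos x) eps) as [Hle | Hlt].
  - exists 0. split; [lra |]. intros k Hk _. pose proof (acos_bound (k * x)). lra.
  - assert (Hlt' : x < cos (acos x - eps)).
    { rewrite <- (cos_acos x) at 1 by lra. apply cos_decreasing_1; lra. }
    pose proof (COS_bound (acos x - eps)).
    (* As |x| <= 1, k x - x <= 1 - k, so this bound on [k] gives k x <= cos (acos x - eps). *)
    exists (1 - (cos (acos x - eps) - x)). split; [lra |]. intros k Hk Hk0.
    rewrite <- (acos_cos (acos x - eps)) by lra. apply acos_le; nra. }
destruct Hk as (k0 & Hk0 & Hk).
exists (Rmax 0 (Rmax (cos eps) k0)).
pose proof (Rmax_l 0 (Rmax (cos eps) k0)). pose proof (Rmax_r 0 (Rmax (cos eps) k0)).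
pose proof (Rmax_l (cos eps) k0). pose proof (Rmax_r (cos eps) k0).
assert (Rmax 0 (Rmax (cos eps) k0) < 1) by (repeat apply Rmax_lub_lt; lra).
split; [lra |]. split; [apply Hk; lra |].
pose proof (COS_bound eps). rewrite <- (acos_cos eps) at 2 by lra. apply acos_le; lra.
Qed.

(** With difference quotients d tending to [w], rad^2 grows by 2 h <g 0, d> + h^2 |d|^2. The first
    term is nearly nonpositive, and [B] bounds |d|^2 in the second. *)
Lemma rad_increment_right (g : R -> pt) (w : pt) (eps : R) :
  init_vel g w -> rad (g 0) <> 0 -> eucl_dot (g 0) w <= 0 -> 0 < eps ->
  at_right 0 (fun h => rad (g h) - rad (g 0) <= eps * h).
Proof.
intros [H1 H2] H0 Hw Heps. pose proof (rad_ge_0 (g 0)) as Hr0.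
set (r := rad (g 0)) in *.
set (B := (Rabs (fst w) + 1) ^ 2 + (Rabs (snd w) + 1) ^ 2).
assert (HB : 0 < B).
{ unfold B. pose proof (Rabs_pos (fst w)). pose proof (Rabs_pos (snd w)). nra. }
assert (Hd : 0 < Rmin 1 (eps / 4)) by (apply Rmin_glb_lt; lra).
assert (Hh : 0 < eps * r / B) by (apply Rdiv_lt_0_compat; nra).
assert (L1 := proj1 (filterlim_locally _ _) H1 (mkposreal _ Hd)).
assert (L2 := proj1 (filterlim_locally _ _) H2 (mkposreal _ Hd)).
assert (L3 : at_right 0 (fun h => 0 < h < eps * r / B)).
{ exists (mkposreal _ Hh). intros h Hh1 Hh2. change (Rabs (h - 0) < eps * r / B) in Hh1.
  rewrite Rminus_0_r, Rabs_pos_eq in Hh1; lra. }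
generalize (filter_and _ _ L3 (filter_and _ _ L1 L2)). apply filter_imp.
intros h [Hh1 [Hb1 Hb2]].
change (Rabs ((fst (g h) - fst (g 0)) / h - fst w) < Rmin 1 (eps / 4)) in Hb1.
change (Rabs ((snd (g h) - snd (g 0)) / h - snd w) < Rmin 1 (eps / 4)) in Hb2.
pose proof (Rmin_l 1 (eps / 4)). pose proof (Rmin_r 1 (eps / 4)).
set (d1 := (fst (g h) - fst (g 0)) / h) in *. set (d2 := (snd (g h) - snd (g 0)) / h) in *.
assert (E1 : fst (g h) = fst (g 0) + h * d1) by (unfold d1; field; lra).
assert (E2 : snd (g h) = snd (g 0) + h * d2) by (unfold d2; field; lra).
pose proof (rad_sqr (g h)) as HR. pose proof (rad_sqr (g 0)) as HR0. fold r in HR0.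
rewrite E1, E2 in HR. set (R' := rad (g h)) in *.
set (q1 := fst (g 0)) in *. set (q2 := snd (g 0)) in *.
assert (Hq1 : Rabs q1 <= r) by (apply Rsqr_incr_0_var; [rewrite <- Rsqr_abs; unfold Rsqr; nra | auto]).
assert (Hq2 : Rabs q2 <= r) by (apply Rsqr_incr_0_var; [rewrite <- Rsqr_abs; unfold Rsqr; nra | auto]).
assert (Hqd : q1 * d1 + q2 * d2 <= r * (eps / 2)).
{ unfold eucl_dot in Hw. fold q1 q2 in Hw.
  assert (A1 : q1 * (d1 - fst w) <= r * (eps / 4)).
  { eapply Rle_trans; [apply Rle_abs |]. rewrite Rabs_mult. apply Rmult_le_compat; try apply Rabs_pos; lra. }
  assert (A2 : q2 * (d2 - snd w) <= r * (eps / 4)).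
  { eapply Rle_trans; [apply Rle_abs |]. rewrite Rabs_mult. apply Rmult_le_compat; try apply Rabs_pos; lra. }
  lra. }
assert (Hdd : d1 ^ 2 + d2 ^ 2 <= B).
{ assert (forall d x, Rabs (d - x) < Rmin 1 (eps / 4) -> d ^ 2 <= (Rabs x + 1) ^ 2).
  { intros d x Hdx. rewrite <- (Rsqr_pow2 d), Rsqr_abs, Rsqr_pow2. apply pow_incr.
    split; [apply Rabs_pos |]. replace d with ((d - x) + x) by ring.
    eapply Rle_trans; [apply Rabs_triang | lra]. }
  unfold B. apply Rplus_le_compat; auto. }
assert (HhB : h * B <= eps * r).
{ destruct Hh1 as [_ Hh1]. apply Rlt_le in Hh1. apply (Rmult_le_compat_r B) in Hh1; [| lra].
  replace (eps * r / B * B) with (eps * r) in Hh1 by (field; lra). exact Hh1. }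
assert (HRR : R' * R' - r * r <= 2 * r * (eps * h)).
{ rewrite HR, HR0.
  replace (_ - _) with (2 * h * (q1 * d1 + q2 * d2) + h * (h * (d1 ^ 2 + d2 ^ 2))) by ring.
  assert (h * (h * (d1 ^ 2 + d2 ^ 2)) <= h * (eps * r)).
  { apply Rmult_le_compat_l; [lra |]. apply Rle_trans with (h * B); [apply Rmult_le_compat_l; lra | exact HhB]. }
  assert (2 * h * (q1 * d1 + q2 * d2) <= 2 * h * (r * (eps / 2))) by (apply Rmult_le_compat_l; lra).
  lra. }
apply Rmult_le_reg_l with (2 * r); [lra |]. pose proof (pow2_ge_0 (R' - r)). nra.
Qed.

Section Ray.

Variables (m : R -> R) (rho Y y lam eta : R) (g : R -> pt).
Hypothesis Hm : profile m.
Hypothesis HrY : 0 < rho < Y.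
(** Room for curves that nearly realize the distance between ray points of radius at most [Y]; the
    bounds on m' are therefore assumed up to [y]. *)
Hypothesis HYy : Y < y.
Hypothesis Hlam : 0 < lam.
Hypothesis Hder : forall r, rho <= r < y -> 0 < Derive m r <= lam.
Hypothesis Heta : 2 * lam + eta < 1.
Hypothesis Hratio : 2 * m rho <= eta * m Y.
Hypothesis Hder1 : forall r, 0 < r < y -> Rabs (Derive m r) <= 1.
Hypothesis Hray : is_ray m g.
Hypothesis Hg0 : rad (g 0) = rho.

Lemma ray_gdist (s t : R) : 0 <= s <= t -> gdist m (g s) (g t) = Finite (t - s).
Proof.
intros H. rewrite Hray by lra. rewrite Rabs_minus_sym, Rabs_pos_eq by lra. reflexivity.
Qed.

Lemma ray_rad_lipschitz (s t : R) : 0 <= s -> 0 <= t -> Rabs (rad (g s) - rad (g t)) <= Rabs (s - t).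
Proof.
intros Hs Ht. rewrite (Rabs_minus_sym (rad _)).
apply (rad_increment_le_gdist m (g s) (g t)); auto.
Qed.

Lemma ray_reaches : exists T, 0 <= T /\ rad (g T) = Y /\ forall s, 0 <= s <= T -> rad (g s) <= Y.
Proof.
(* If the radius at time [T] were below [Y], the Euclidean segment would join [g 0] to [g T] with
   length at most rho + Y < T. *)
set (T := rho + Y + 1).
assert (HT : Y <= rad (g T)).
{ apply Rnot_lt_le; intros Hlt.
  assert (Hle : forall r, 0 <= r <= Y -> m r <= r).
  { intros r Hr. pose proof (profile_0 m Hm) as E.
    assert (m r - m 0 <= 1 * (r - 0)); [| lra].
    apply (derive_le_increment m (Derive m)); try lra.
    - intros; now apply profile_is_derive.
    - intros; now apply profile_continuous.
    - intros t Ht. generalize (Rle_abs (Derive m t)) (Hder1 t ltac:(lra)). lra. }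
  pose proof (gdist_le_rad_plus m (g 0) (g T) (T - 0) Y Hm Hle ltac:(lra) ltac:(lra)
    (ray_gdist 0 T ltac:(unfold T; lra))).
  unfold T in *. lra. }
destruct (first_visit (fun t => rad (g t)) T Y) as (t & Ht1 & Ht2 & Ht3); auto.
- unfold T; lra.
- lra.
- intros; apply ray_rad_lipschitz; lra.
- exists t. split; [lra | auto].
Qed.

(** [flat] is tested in the direction [u] of the chord from the unit vector [e] of [g 0] to the unit
    vector [f] of [g s]. It rises by (m(rho) + m(rad (g s))) sin v, and m is at least m(rho) beyond
    rho. *)
Lemma chord_le_time (T s : R) :
  (forall t, 0 <= t <= T -> rad (g t) <= Y) -> 0 <= s <= T -> rho <= rad (g s) ->
  2 * m rho * sin (acos (cosine (direction (g 0)) (g s)) / 2) <= s.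
Proof.
intros HT Hs Hr.
pose proof (proj2 (proj2 (proj2 (proj2 Hm)))) as Hpos.
assert (HM : m rho <= m (rad (g s))).
{ apply (profile_incr m rho (rad (g s)) lam Hm); try lra.
  intros r Hr'. apply Hder. specialize (HT s Hs). lra. }
pose proof (Hpos rho ltac:(lra)) as Ha.
set (e := direction (g 0)). set (f := direction (g s)).
assert (He : eucl_dot e e = 1) by (apply direction_unit; lra).
assert (Hf : eucl_dot f f = 1) by (apply direction_unit; lra).
pose proof (cosine_bound e (g s) He ltac:(lra)) as Hx.
set (x := cosine e (g s)) in *.
assert (Ex : x = eucl_dot f e) by apply cosine_direction.
pose proof (acos_bound x) as Hab.
set (v := acos x / 2).
assert (Hv : 0 <= sin v) by (apply sin_ge_0; unfold v; lra).
assert (Hsq : 2 * (1 - x) = (2 * sin v) ^ 2).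
{ rewrite <- (cos_acos x) at 1 by lra. replace (acos x) with (2 * v) by (unfold v; field).
  rewrite cos_2a_sin. ring. }
destruct (Rle_lt_or_eq_dec _ _ Hv) as [Hv' | Hv']; [| rewrite <- Hv'; lra].
(* The distance between [e] and [f] is 2 sin v, so this is a unit vector; the case sin v = 0 was
   settled before. *)
set (u := ((fst f - fst e) / (2 * sin v), (snd f - snd e) / (2 * sin v)) : pt).
assert (Hu : eucl_dot u u = 1).
{ unfold u, eucl_dot in *; cbn [fst snd].
  transitivity (((fst f * fst f + snd f * snd f) + (fst e * fst e + snd e * snd e)
    - 2 * (fst f * fst e + snd f * snd e)) / (2 * sin v) ^ 2); [field; lra |].
  rewrite He, Hf, <- Ex, <- Hsq. field. nra. }
assert (HF : Rabs (flat m u (g s) - flat m u (g 0)) <= s - 0).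
{ apply (locally_short_is_short (fun t => flat m u (g t)) 0 s (y - Y)); try lra.
  intros t1 t2 H1 H2 H3 H4.
  apply (increment_le_gdist m (flat m u) (g t1) (g t2) (t2 - t1) (y - Y)); auto; [apply ray_gdist; lra |].
  intros c Hc _ _ Hcr. apply flat_increment_le_length; auto.
  intros t Ht Hne. apply Hder1. specialize (Hcr t Ht). pose proof (rad_ge_0 (c t)).
  specialize (HT t1 ltac:(lra)). apply Rabs_lt_between in Hcr. lra. }
assert (E : forall t, flat m u (g t) = m (rad (g t)) * eucl_dot (direction (g t)) u).
{ intros t. unfold flat. destruct (Req_EM_T (rad (g t)) 0) as [E0 | E0].
  - rewrite E0, (profile_0 m Hm). pose proof (rad_sqr (g t)) as H. rewrite E0 in H.
    assert (fst (g t) = 0 /\ snd (g t) = 0) as [E1 E2] by (split; nra).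
    unfold eucl_dot. rewrite E1, E2. ring.
  - rewrite <- (slope_mult m) by apply Hm. unfold eucl_dot, direction; cbn [fst snd]. field; auto. }
rewrite !E, Hg0 in HF. fold e f in HF.
assert (E1 : eucl_dot f u = sin v).
{ transitivity ((eucl_dot f f - eucl_dot f e) / (2 * sin v)).
  - unfold u, eucl_dot; cbn [fst snd]. field; lra.
  - rewrite Hf, <- Ex. replace (1 - x) with (2 * sin v * sin v) by nra. field; lra. }
assert (E2 : eucl_dot e u = - sin v).
{ transitivity ((eucl_dot f e - eucl_dot e e) / (2 * sin v)).
  - unfold u, eucl_dot; cbn [fst snd]. field; lra.
  - rewrite He, <- Ex. replace (x - 1) with (- (2 * sin v * sin v)) by nra. field; lra. }
rewrite E1, E2 in HF. apply Rabs_le_between in HF. nra.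
Qed.

(** The increment of the Clairaut function with axis through [g T], for which the angle is 0 at time
    [T], in the limit of damping factors tending to 1. *)
Lemma clairaut_le_time (T s e : R) :
  0 <= s <= T -> (forall t, s <= t <= T -> rho <= rad (g t) <= Y) -> rad (g T) = Y ->
  0 <= e < m rho ->
  e * acos (cosine (direction (g T)) (g s)) + RInt (radial_part m e) rho Y - RInt (radial_part m e) rho (rad (g s))
    <= T - s.
Proof.
intros Hs HT HgT He.
pose proof (proj2 (proj2 (proj2 (proj2 Hm)))) as Hpos.
set (w := direction (g T)).
assert (Hw : eucl_dot w w = 1) by (apply direction_unit; lra).
set (H := fun r => RInt (radial_part m e) rho r).
fold (H Y) (H (rad (g s))).
(* Nearly minimizing curves may dip below radius [rho]; since e < m(rho), the Clairaut function
   still makes sense on a small collar there. *)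
assert (Hd1 : exists d, 0 < d <= rho /\ forall r, Rabs (r - rho) < d -> e <= m r).
{ assert (Hgap : 0 < m rho - e) by lra.
  destruct (proj1 (filterlim_locally _ _) (profile_continuous m rho Hm) (mkposreal _ Hgap)) as [d Hd].
  exists (Rmin d rho). split; [split; [apply Rmin_glb_lt; [apply cond_pos | lra] | apply Rmin_r] |].
  intros r Hr. specialize (Hd r).
  assert (Hb : Rabs (m r - m rho) < m rho - e).
  { apply Hd. change (Rabs (r - rho) < d). eapply Rlt_le_trans; [exact Hr | apply Rmin_l]. }
  apply Rabs_lt_between in Hb. lra. }
destruct Hd1 as (d & Hd & Hed).
assert (HW : forall k, 0 <= k < 1 ->
  e * acos (k * cosine w (g s)) - H (rad (g s)) - (e * acos k - H Y) <= T - s).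
{ intros k Hk.
  assert (EP : clairaut e k H w (g T) = e * acos k - H Y).
  { unfold clairaut. rewrite HgT. replace (cosine w (g T)) with 1; [now rewrite Rmult_1_r |].
    rewrite cosine_direction. symmetry. exact Hw. }
  assert (HC : Rabs (clairaut e k H w (g T) - clairaut e k H w (g s)) <= T - s).
  { apply (locally_short_is_short (fun t => clairaut e k H w (g t)) s T (Rmin d (y - Y))); [apply Rmin_glb_lt; lra | lra |].
    intros t1 t2 H1 H2 H3 H4.
    apply (increment_le_gdist m (clairaut e k H w) (g t1) (g t2) (t2 - t1) (Rmin d (y - Y))); auto; [apply ray_gdist; lra |].
    intros c Hc _ _ Hcr. apply clairaut_increment_le_length; auto; [lra |].
    intros t Ht. specialize (Hcr t Ht). specialize (HT t1 ltac:(lra)).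
    pose proof (Rmin_l d (y - Y)). pose proof (Rmin_r d (y - Y)).
    apply Rabs_lt_between in Hcr.
    assert (Hr : 0 < rad (c t)) by lra. split; [exact Hr | split].
    - destruct (Rle_lt_dec rho (rad (c t))) as [Hle | Hlt].
      + apply Rle_trans with (m rho); [lra |].
        apply (profile_incr m rho (rad (c t)) lam Hm); try lra.
        intros r Hr'. apply Hder. lra.
      + apply Hed. rewrite Rabs_left; lra.
    - apply (is_derive_RInt_continuous (radial_part m e) 0 (rad (c t) + rho) rho); try lra.
      intros r Hr'. apply (radial_part_continuous m Hm). lra. }
  rewrite EP in HC. unfold clairaut in HC. apply Rabs_le_between in HC. lra. }
apply Rnot_lt_le; intros Hlt.
set (gap := e * acos (cosine w (g s)) + H Y - H (rad (g s)) - (T - s)).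
assert (Hgap : 0 < gap) by (unfold gap; lra).
pose proof PI_RGT_0 as HPI.
(* Damping costs at most [e * eps] at each end, in total at most 2 m(rho) eps <= gap / 2. *)
assert (Heps : 0 < Rmin PI (gap / (4 * m rho))) by (apply Rmin_glb_lt; [lra | apply Rdiv_lt_0_compat; lra]).
set (eps := Rmin PI (gap / (4 * m rho))) in *.
assert (Hge : m rho * eps <= gap / 4).
{ replace (gap / 4) with (m rho * (gap / (4 * m rho))) by (field; lra).
  apply Rmult_le_compat_l; [lra | apply Rmin_r]. }
destruct (acos_scal_near (cosine w (g s)) eps) as (k & Hk & Hk1 & Hk2).
- apply cosine_bound; [exact Hw |]. specialize (HT s ltac:(lra)). lra.
- split; [exact Heps | apply Rmin_l].
- specialize (HW k Hk).
  assert (e * (acos (cosine w (g s)) - eps) <= e * acos (k * cosine w (g s))) by (apply Rmult_le_compat_l; lra).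
  assert (e * acos k <= e * eps) by (apply Rmult_le_compat_l; lra).
  assert (e * eps <= m rho * eps) by (apply Rmult_le_compat_r; lra).
  unfold gap in *. lra.
Qed.

Lemma ray_leaves_outward (w : pt) : init_vel g w -> 0 < eucl_dot (g 0) w.
Proof.
intros Hw. apply Rnot_le_lt; intros Hin.
assert (HderY : forall r, rho <= r <= Y -> 0 < Derive m r <= lam) by (intros; apply Hder; lra).
assert (Ha : 0 < m rho) by (apply Hm; lra).
destruct ray_reaches as (T & HT0 & HgT & HTY).
assert (HTpos : 0 < T).
{ destruct (Rle_lt_or_eq_dec _ _ HT0) as [H | <-]; [exact H | lra]. }
set (e := direction (g 0)). set (f := direction (g T)).
assert (He : eucl_dot e e = 1) by (apply direction_unit; lra).
assert (Hf : eucl_dot f f = 1) by (apply direction_unit; lra).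
set (psi := acos (eucl_dot e f)).
pose proof (acos_bound (eucl_dot e f)) as Hpsi. fold psi in Hpsi.
destruct (turn_onto m rho Y lam eta Hm HrY Hlam HderY Heta Hratio psi Hpsi) as (c & Hc & Hturn).
assert (Htri : forall s, rad (g s) <> 0 ->
  psi <= acos (cosine e (g s)) + acos (cosine f (g s))).
{ intros s Hs. rewrite !cosine_direction.
  assert (Hds := direction_unit (g s) Hs).
  pose proof (acos_dot_triangle e (direction (g s)) f He Hds Hf) as H.
  replace (eucl_dot e (direction (g s))) with (eucl_dot (direction (g s)) e) in H by (unfold eucl_dot; ring).
  exact H. }
assert (Hup : T <= c * psi + radial_length m rho Y c).
{ assert (Hcf : -1 <= eucl_dot e f <= 1).
  { unfold e. rewrite <- cosine_direction. apply cosine_bound; [exact Hf | lra]. }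
  set (x := fst e * snd f - snd e * fst f).
  assert (Hx : eucl_dot e f ^ 2 + x ^ 2 = 1).
  { transitivity (eucl_dot e e * eucl_dot f f); [unfold x, eucl_dot; ring | rewrite He, Hf; ring]. }
  (* [psi] is unsigned; [s] records on which side of the axis through [g 0] the point [g T] lies. *)
  assert (Hs : exists s, s * s = 1 /\ x = s * sin psi).
  { assert (Hsx : sin psi = Rabs x).
    { unfold psi. rewrite sin_acos by exact Hcf. rewrite <- sqrt_Rsqr_abs. f_equal. unfold Rsqr. nra. }
    rewrite Hsx. destruct (Rle_lt_dec 0 x).
    - exists 1. rewrite Rabs_pos_eq by lra. lra.
    - exists (-1). rewrite Rabs_left by lra. lra. }
  destruct Hs as (s & Hs & Es).
  assert (E0 : g 0 = polar_point e s rho 0).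
  { unfold polar_point. rewrite cos_0, sin_0. rewrite (surjective_pairing (g 0)).
    unfold e, direction; cbn [fst snd]. rewrite Hg0. f_equal; field; lra. }
  assert (ET : g T = polar_point e s Y psi).
  { unfold polar_point. rewrite <- Es. unfold psi. rewrite cos_acos by exact Hcf.
    rewrite (surjective_pairing (g T)).
    assert (F1 : fst (g T) = Y * fst f) by (unfold f, direction; cbn [fst snd]; rewrite HgT; field; lra).
    assert (F2 : snd (g T) = Y * snd f) by (unfold f, direction; cbn [fst snd]; rewrite HgT; field; lra).
    rewrite F1, F2. unfold x, eucl_dot in *. f_equal; f_equal.
    - transitivity (fst f * (fst e * fst e + snd e * snd e)); [rewrite He |]; ring.
    - transitivity (snd f * (fst e * fst e + snd e * snd e)); [rewrite He |]; ring. }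
  rewrite <- Hturn.
  apply (gdist_le_outward_length m rho Y lam Hm HrY HderY c s T e Hc He Hs).
  rewrite Hturn, <- E0, <- ET, ray_gdist by lra. f_equal. ring. }
destruct (last_visit (fun t => rad (g t)) T rho) as (t1 & Ht1 & Hr1 & Hout).
{ lra. } { lra. } { lra. } { intros; apply ray_rad_lipschitz; lra. }
assert (E1 : t1 = 0).
{ set (v := acos (cosine e (g t1)) / 2).
  pose proof (cosine_bound e (g t1) He ltac:(lra)) as Hx.
  pose proof (acos_bound (cosine e (g t1))) as Hv.
  destruct (Rle_lt_or_eq_dec 0 v ltac:(unfold v; lra)) as [Hv0 | Hv0].
  (* [t1] is at least the chord, and [T - t1] at least the Clairaut bound for [c'] with an angle no
     less than [psi - 2 * v]; by [detour_longer] their sum exceeds the bound [Hup] on [T]. *)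
  - exfalso.
    destruct (detour_longer m rho Y lam eta Hm HrY Hlam HderY Heta Hratio c v) as (c' & Hc' & Hlt);
      [exact Hc | lra | unfold v in *; lra |].
    rewrite Hturn in Hlt.
    pose proof (chord_le_time T t1 HTY Ht1 ltac:(lra)) as Hchord. fold e v in Hchord.
    pose proof (clairaut_le_time T t1 c' Ht1) as Hcl. fold f in Hcl. rewrite Hr1 in Hcl.
    rewrite (RInt_point (V := R_CompleteNormedModule)) in Hcl.
    fold (radial_length m rho Y c') in Hcl. unfold zero in Hcl; simpl in Hcl.
    assert (Hcl' : c' * acos (cosine f (g t1)) + radial_length m rho Y c' - 0 <= T - t1).
    { apply Hcl; [| exact HgT | lra]. intros t Ht. split; [apply Hout; lra | apply HTY; lra]. }
    assert (Hmax : Rmax (psi - 2 * v) 0 <= acos (cosine f (g t1))).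
    { apply Rmax_lub; [| apply acos_bound]. pose proof (Htri t1 ltac:(lra)). unfold v. lra. }
    pose proof (Rmult_le_compat_l c' _ _ ltac:(lra) Hmax). lra.
  (* Equal radius and equal direction force [g t1 = g 0], and a ray visits no point twice. *)
  - assert (Hcos : cosine e (g t1) = 1).
    { rewrite <- (cos_acos (cosine e (g t1))) by exact Hx.
      replace (acos (cosine e (g t1))) with 0 by (unfold v in Hv0; lra). apply cos_0. }
    pose proof (cosine_sqr e (g t1) He ltac:(lra)) as Hsq.
    assert (Hcross : (fst (g t1) * snd e - snd (g t1) * fst e) / rad (g t1) = 0) by (rewrite Hcos in Hsq; nra).
    assert (Hdot : eucl_dot (g t1) e = rho).
    { unfold cosine in Hcos. rewrite Hr1 in Hcos. apply Rmult_eq_reg_r with (/ rho); [| apply Rinv_neq_0_compat; lra].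
      rewrite Rinv_r by lra. exact Hcos. }
    assert (Hcr : fst (g t1) * snd e - snd (g t1) * fst e = 0).
    { rewrite Hr1 in Hcross. apply Rmult_eq_reg_r with (/ rho); [| apply Rinv_neq_0_compat; lra].
      rewrite Rmult_0_l. exact Hcross. }
    assert (Eg : g t1 = g 0).
    { rewrite (surjective_pairing (g t1)), (surjective_pairing (g 0)).
      assert (F1 : fst (g 0) = rho * fst e) by (unfold e, direction; cbn [fst snd]; rewrite Hg0; field; lra).
      assert (F2 : snd (g 0) = rho * snd e) by (unfold e, direction; cbn [fst snd]; rewrite Hg0; field; lra).
      rewrite F1, F2. unfold eucl_dot in *. f_equal.
      - transitivity (fst (g t1) * (fst e * fst e + snd e * snd e)); [rewrite He; ring |].
        rewrite <- Hdot. transitivity ((fst (g t1) * fst e + snd (g t1) * snd e) * fst e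
          + (fst (g t1) * snd e - snd (g t1) * fst e) * snd e); [ring | rewrite Hcr; ring].
      - transitivity (snd (g t1) * (fst e * fst e + snd e * snd e)); [rewrite He; ring |].
        rewrite <- Hdot. transitivity ((fst (g t1) * fst e + snd (g t1) * snd e) * snd e
          - (fst (g t1) * snd e - snd (g t1) * fst e) * fst e); [ring | rewrite Hcr; ring]. }
    pose proof (ray_gdist 0 t1 ltac:(lra)) as D1. pose proof (ray_gdist 0 0 ltac:(lra)) as D2.
    rewrite Eg, D2 in D1. injection D1. lra. }
rewrite E1 in Hout.
(* Thus c / m(rho) = 1 - 3 eps. The two losses below, [eps] from the radial growth and [eps / 2]
   from replacing v by sin v, stay under 3 eps. *)
set (eps := (1 - c / m rho) / 3).
pose proof (div_lt_1 c (m rho) Hc) as Hcm.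
assert (Heps : 0 < eps) by (unfold eps; lra).
(* With h < m(rho) eps the chord bound forces 2 sin v < eps, hence cos v >= 1 - eps / 2. *)
assert (Hd : 0 < Rmin T (m rho * eps)) by (apply Rmin_glb_lt; nra).
assert (L : at_right 0 (fun h => 0 < h < Rmin T (m rho * eps))).
{ exists (mkposreal _ Hd). intros h Hh1 Hh2. change (Rabs (h - 0) < Rmin T (m rho * eps)) in Hh1.
  rewrite Rminus_0_r, Rabs_pos_eq in Hh1; lra. }
assert (L2 := rad_increment_right g w eps Hw ltac:(lra) Hin Heps).
destruct (filter_ex _ (filter_and _ _ L L2)) as (h & Hh & Hrh).
pose proof (Rmin_l T (m rho * eps)). pose proof (Rmin_r T (m rho * eps)).
rewrite Hg0 in Hrh.
assert (Hrho : rho <= rad (g h)) by (apply Hout; lra).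
pose proof (chord_le_time T h HTY ltac:(lra) Hrho) as Hchord. fold e in Hchord.
pose proof (clairaut_le_time T h c ltac:(lra)) as Hcl.
assert (Hcl' := Hcl (fun t Ht => conj (Hout t ltac:(lra)) (HTY t ltac:(lra))) HgT Hc). clear Hcl.
fold f (radial_length m rho Y c) in Hcl'.
assert (Hint : RInt (radial_part m c) rho (rad (g h)) <= rad (g h) - rho).
{ apply Rle_trans with (RInt (fun _ => 1) rho (rad (g h)));
    [| rewrite (RInt_const (V := R_CompleteNormedModule)); unfold scal; simpl; unfold mult; simpl; lra].
  apply RInt_le; [exact Hrho | | apply ex_RInt_const |].
  - apply (ex_RInt_continuous (V := R_CompleteNormedModule)). intros r Hr.
    rewrite Rmin_left in Hr by lra. apply radial_part_continuous; [exact Hm | lra].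
  - intros r _. unfold radial_part. rewrite <- sqrt_1 at 2. apply sqrt_le_1_alt.
    pose proof (pow2_ge_0 (c / m r)). lra. }
pose proof (Htri h ltac:(lra)) as Htri'.
pose proof (cosine_bound e (g h) He ltac:(lra)) as Hx.
pose proof (acos_bound (cosine e (g h))) as Hv.
set (v := acos (cosine e (g h)) / 2) in *.
(* [Hup] minus the Clairaut bound on [T - h] with the same constant [c]: the radial lengths cancel
   up to the increase of [rad], which is at most [eps * h] as [w] does not point outward. *)
assert (Hmain : h <= c * (2 * v) + eps * h).
{ assert (psi - 2 * v <= acos (cosine f (g h))) by (unfold v; lra).
  pose proof (Rmult_le_compat_l c _ _ ltac:(lra) H1). lra. }
assert (Hvb : 0 <= v <= PI / 2) by (unfold v; lra).
assert (Hsv : 0 <= sin v) by (apply sin_ge_0; lra).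
assert (Hcv : 0 <= cos v) by (apply cos_ge_0; lra).
assert (Hvcos : v * cos v <= sin v).
{ destruct (Rle_lt_or_eq_dec 0 v ltac:(lra)) as [H1 | <-]; [left; apply mul_cos_lt_sin; lra | rewrite sin_0; lra]. }
pose proof (sin2_cos2 v) as Hsc. unfold Rsqr in Hsc.
assert (Hcs : 1 - sin v <= cos v) by nra.
assert (Hss : 2 * sin v < eps).
{ apply Rmult_lt_reg_l with (m rho); [lra |]. nra. }
assert (Hvs : v * (1 - eps / 2) <= sin v).
{ apply Rle_trans with (v * cos v); [apply Rmult_le_compat_l; lra | exact Hvcos]. }
assert (Hch : c * (2 * sin v) <= (1 - 3 * eps) * h).
{ replace (1 - 3 * eps) with (c / m rho) by (unfold eps; field; lra).
  replace (c * (2 * sin v)) with (c / m rho * (2 * m rho * sin v)) by (field; lra).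
  apply Rmult_le_compat_l; lra. }
assert (Hfin : h * (1 - eps) * (1 - eps / 2) <= (1 - 3 * eps) * h).
{ apply Rle_trans with (c * (2 * v) * (1 - eps / 2)).
  - apply Rmult_le_compat_r; [unfold eps; lra | lra].
  - apply Rle_trans with (c * (2 * sin v)); [| exact Hch].
    replace (c * (2 * v) * (1 - eps / 2)) with (c * (2 * (v * (1 - eps / 2)))) by ring.
    apply Rmult_le_compat_l; lra. }
assert (0 < h * eps) by (apply Rmult_lt_0_compat; lra). nra.
Qed.

End Ray.

(** * Concave profiles *)

Lemma Derive_profile_decr (n : R -> R) (r s : R) :
  profile n -> (forall t, 0 < t -> 0 <= curv n t) -> 0 <= r <= s -> Derive n s <= Derive n r.
Proof.
intros Hn Hcurv Hrs.
assert (HD : forall t, is_derive (Derive n) t (Derive_n n 2 t)).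
{ intros t. apply Derive_correct. apply (proj1 Hn 2%nat). }
assert (Derive n s - Derive n r <= 0 * (s - r)); [| lra].
apply (derive_le_increment (Derive n) (Derive_n n 2)); try lra.
- intros; apply HD.
- intros t _; exact (is_derive_continuous _ _ _ (HD t)).
- intros t Ht. specialize (Hcurv t ltac:(lra)). unfold curv in Hcurv.
  assert (0 < n t) by (apply Hn; lra).
  apply (Rmult_le_compat_r (n t)) in Hcurv; [| lra].
  unfold Rdiv in Hcurv. rewrite Rmult_assoc, Rinv_l in Hcurv; lra.
Qed.

(** Once n' <= 0 at [r], concavity keeps n <= n(r) from there on, against n tending to infinity. *)
Lemma Derive_profile_pos (n : R -> R) (r : R) :
  profile n -> (forall t, 0 < t -> 0 <= curv n t) ->
  filterlim n (Rbar_locally p_infty) (Rbar_locally p_infty) ->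
  0 <= r -> 0 < Derive n r.
Proof.
intros Hn Hcurv Hlim Hr. apply Rnot_le_lt; intros Hle.
assert (Hev : Rbar_locally p_infty (fun s => n r < n s)).
{ apply (Hlim (fun v => n r < v)). exists (n r). auto. }
destruct Hev as [M HM].
pose proof (Rmax_l M r). pose proof (Rmax_r M r).
specialize (HM (Rmax M r + 1) ltac:(lra)).
assert (n (Rmax M r + 1) - n r <= 0 * (Rmax M r + 1 - r)); [| lra].
apply (derive_le_increment n (Derive n)); try lra.
- intros; now apply profile_is_derive.
- intros; now apply profile_continuous.
- intros t Ht. pose proof (Derive_profile_decr n r t Hn Hcurv ltac:(lra)). lra.
Qed.

Theorem theorem1p10 (n : R -> R) (x : R) :
  von_Mangoldt n ->
  (forall r, 0 < r -> 0 <= curv n r) ->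
  filterlim n (Rbar_locally p_infty) (Rbar_locally p_infty) ->
  0 < x -> Derive n x < 1 / 2 ->
  forall z, x < z ->
    exists y, z < y /\
      forall m : R -> R, von_Mangoldt m ->
        (forall r, 0 <= r <= y -> m r = n r) ->
        forall q : pt, in_Cm m q -> ~ (x <= rad q <= z).
Proof.
intros [Hn _] Hcurv Hlim Hx Hdx z Hz.
set (lam := Derive n x) in *.
(* Then 2 lam + eta = lam + 1/2 < 1. *)
set (eta := 1 / 2 - lam).
assert (Hlam : 0 < lam) by (apply Derive_profile_pos; auto; lra).
assert (HD1 : forall r, 0 < r -> 0 < Derive n r <= 1).
{ intros r Hr. split; [apply Derive_profile_pos; auto; lra |].
  rewrite <- (is_derive_unique n 0 1) by apply Hn.
  apply Derive_profile_decr; auto; lra. }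
(* [Y] is chosen for the radius [z]; as n increases, it works for every rho in [[x, z]]. *)
assert (Hex : exists Y, z < Y /\ 2 * n z <= eta * n Y).
{ assert (Hev : Rbar_locally p_infty (fun s => 2 * n z / eta < n s)).
  { apply (Hlim (fun v => 2 * n z / eta < v)). exists (2 * n z / eta). auto. }
  destruct Hev as [M HM].
  pose proof (Rmax_l M z). pose proof (Rmax_r M z).
  exists (Rmax M z + 1). split; [lra |].
  specialize (HM (Rmax M z + 1) ltac:(lra)).
  apply Rlt_le, (Rmult_le_compat_l eta) in HM; [| unfold eta; lra].
  replace (eta * (2 * n z / eta)) with (2 * n z) in HM by (field; unfold eta; lra). exact HM. }
destruct Hex as (Y & HzY & HY).
exists (Y + 1). split; [lra |].
intros m [Hm _] Hmn q Hq Hrho.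
assert (HDm : forall r, 0 < r < Y + 1 -> Derive m r = Derive n r).
{ intros r Hr. apply Derive_ext_loc.
  apply (locally_interval _ r 0 (Y + 1)); [apply Hr | apply Hr |].
  intros s H1 H2. simpl in *. apply Hmn; lra. }
pose proof (rad_sqr q) as Hqq.
(* Tested on the unit vector at [q] pointing to the origin. *)
destruct (Hq (- fst q / rad q, - snd q / rad q)) as (g & w & Hray & Hg0 & Hw & Hangle).
{ rewrite gdot_polar by lra. unfold radial, angular, eucl_dot; cbn [fst snd].
  transitivity (((fst q * fst q + snd q * snd q) / (rad q * rad q)) ^ 2); [field; lra |].
  rewrite <- Hqq. field; lra. }
assert (Hout : 0 < eucl_dot q w).
{ rewrite <- Hg0.
  apply (ray_leaves_outward m (rad q) Y (Y + 1) lam eta g); auto; try lra.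
  - intros r Hr. rewrite HDm by lra. split; [apply HD1; lra |].
    apply Derive_profile_decr; auto; lra.
  - unfold eta; lra.
  - rewrite !Hmn by lra. apply Rle_trans with (2 * n z); [| exact HY].
    assert (- n z - - n (rad q) <= 0 * (z - rad q)); [| lra].
    apply (derive_le_increment (fun t => - n t) (fun t => - Derive n t)); try lra.
    + intros t Ht. apply (is_derive_opp (V := R_NormedModule) n), profile_is_derive, Hn.
    + intros t Ht. apply (continuous_opp (V := R_NormedModule) n), profile_continuous, Hn.
    + intros t Ht. generalize (HD1 t ltac:(lra)). lra.
  - intros r Hr. rewrite HDm by lra. generalize (HD1 r ltac:(lra)).
    intros H. rewrite Rabs_pos_eq; lra.
  - now rewrite Hg0. }
unfold gdot in Hangle. destruct Req_EM_T as [E | _]; [lra |].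
(* The test vector has no angular part, so its metric product with [w] is - <q, w> / rad q, of the
   opposite sign to [Hout]. *)
assert (E : eucl_dot q w = - (rad q * (eucl_dot (- fst q / rad q, - snd q / rad q) (fst q / rad q, snd q / rad q)
  * eucl_dot w (fst q / rad q, snd q / rad q)
  + m (rad q) ^ 2 * (eucl_dot (- fst q / rad q, - snd q / rad q) (- snd q / rad q, fst q / rad q) / rad q)
    * (eucl_dot w (- snd q / rad q, fst q / rad q) / rad q)))).
{ unfold eucl_dot; cbn [fst snd].
  transitivity ((fst q * fst w + snd q * snd w) * ((fst q * fst q + snd q * snd q) / (rad q * rad q))).
  - rewrite <- Hqq. field; lra.
  - field; lra. }
rewrite E in Hout.
pose proof (Rmult_le_compat_l (rad q) _ _ ltac:(lra) Hangle). lra.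
Qed.
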